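(* Let $B$ be a finite-dimensional C*-algebra. The Exel crossed product $B\rtimes_{\mathrm{id},\mathrm{id}}\mathbb{N}$ of the trivial Exel system $(B,\mathrm{id},\mathrm{id})$ is isomorphic to $B\otimes C(\mathbb{T})$.
   Context: Let $\mathcal{C}$ be a unital C*-algebra and $\alpha\colon\mathcal{C}\to\mathcal{C}$ a $*$-endomorphism. A transfer operator is a positive linear map $\mathcal{L}\colon\mathcal{C}\to\mathcal{C}$ with $\mathcal{L}(\alpha(f)g)=f\mathcal{L}(g)$ for all $f,g\in\mathcal{C}$; then $(\mathcal{C},\alpha,\mathcal{L})$ is an Exel system. The Toeplitz algebra $\mathcal{T}(\mathcal{C},\alpha,\mathcal{L})$ is the universal (unital) C*-algebra generated by a copy of $\mathcal{C}$ and an element $S$ with $Sf=\alpha(f)S$ and $\mathcal{L}(f)=S^*fS$ for all $f\in\mathcal{C}$. A redundancy is a pair $(f,k)$ with $f\in\mathcal{C}$, $k\in\overline{\mathcal{C}SS^*\mathcal{C}}$ (closed linear span) and $fgS=kgS$ for all $g\in\mathcal{C}$. The Exel crossed product $\mathcal{C}\rtimes_{\alpha,\mathcal{L}}\mathbb{N}$ is the quotient of $\mathcal{T}(\mathcal{C},\alpha,\mathcal{L})$ by the closed two-sided ideal generated by the differences $f-k$ of redundancies $(f,k)$. $\mathbb{T}$ is the unit circle. *)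

(* Defs.v *)
From HB Require Import structures.
From mathcomp Require Import all_boot all_order all_algebra complex.
From mathcomp Require Import all_classical all_reals all_analysis.
From mathcomp Require Import ring.

Set Implicit Arguments.
Unset Strict Implicit.
Unset Printing Implicit Defensive.

Import Order.TTheory GRing.Theory Num.Theory numFieldNormedType.Exports.

Local Open Scope classical_set_scope.
Local Open Scope ring_scope.
Local Open Scope complex_scope.

HB.instance Definition _ (R : rcfType) := NormedModule.copy R[i] R[i]^o.

(* Unital C*-algebras.  Norms take their values in R[i], as always for a
   normedModType over R[i].  The zero algebra (0 = 1) is allowed.  The product
   is a field of the mixin, and not inherited from pzRingType, because
   Hierarchy Builder cannot join pzRingType with normedModType. *)
HB.mixin Record isCStarAlgebra (R : realType) A
    & CompleteNormedModule R[i] A := {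
  cs_one : A;
  cs_mul : A -> A -> A;
  star : A -> A;
  cs_mulA : associative cs_mul;
  cs_mul1l : left_id cs_one cs_mul;
  cs_mul1r : right_id cs_one cs_mul;
  cs_mulDl : left_distributive cs_mul +%R;
  cs_mulDr : right_distributive cs_mul +%R;
  cs_scaleAl : forall (c : R[i]) (x y : A),
    c *: cs_mul x y = cs_mul (c *: x) y;
  cs_scaleAr : forall (c : R[i]) (x y : A),
    c *: cs_mul x y = cs_mul x (c *: y);
  starK : involutive star;
  starD : {morph star : x y / x + y};
  starZ : forall (c : R[i]) (x : A), star (c *: x) = c^* *: star x;
  starM : forall x y : A, star (cs_mul x y) = cs_mul (star y) (star x);
  cs_normM : forall x y : A, `|cs_mul x y| <= `|x| * `|y|;
  cs_norm_star : forall x : A, `|cs_mul (star x) x| = `|x| ^+ 2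
}.

#[short(type="cstarAlgType")]
HB.structure Definition CStarAlgebra (R : realType) :=
  {A of CompleteNormedModule R[i] A & isCStarAlgebra R A}.

HB.instance Definition _ (R : realType) (A : cstarAlgType R) :=
  GRing.Zmodule_isPzRing.Build (@CStarAlgebra.sort R A)
    cs_mulA cs_mul1l cs_mul1r cs_mulDl cs_mulDr.

Section ComplexTopology.
Variable R : realType.
Implicit Types (z : R[i]) (a : R).

Lemma normc_real a : `|a%:C| = `|a|%:C :> R[i].
Proof. by rewrite normc_def /= expr0n /= addr0 sqrtr_sqr. Qed.

Lemma ltc0_real (e : R[i]) : 0 < e -> exists2 d : R, 0 < d & e = d%:C.
Proof.
move=> e0; have /complex_realP[d ed] : e \is Num.real by exact: gtr0_real.
by exists d => //; rewrite -ltcR -ed.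
Qed.

Lemma Re_continuous : continuous (@complex.Re R : R[i] -> R).
Proof.
move=> z; apply/(@cvgrPdist_lt _ _ _ _ (nbhs_filter z)) => e e0.
have e0' : 0 < e%:C :> R[i] by rewrite ltcR.
apply: (@filterS _ _ (nbhs_filter z) _ _ _ (nbhsx_ballx z _ e0')) => w.
rewrite -ball_normE /= => zw.
rewrite -ltcR; apply: le_lt_trans zw.
by have := normc_ge_Re (z - w); case: (z) (w) => [? ?] [? ?].
Qed.

Lemma real_complex_continuous : continuous (fun a : R => a%:C : R[i]).
Proof.
move=> a; apply/cvgrPdist_lt => _ /ltc0_real[d d0 ->].
near=> b; rewrite -rmorphB /= normc_real ltcR.
by near: b; apply: cvgr_dist_lt.
Unshelve. all: by end_near. Qed.

Lemma mulc_continuous (c : R[i]) : continuous (fun z : R[i] => c * z).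
Proof.
move=> z; have Fz := nbhs_filter z.
by apply: cvgM; [exact: cvg_cst | exact: cvg_id].
Qed.

Lemma Im_continuous : continuous (@complex.Im R : R[i] -> R).
Proof.
have -> : @complex.Im R = fun z => complex.Re ((- 'i%C) * z).
  by apply/funext => -[a b] /=; rewrite oppr0 mul0r add0r mulN1r opprK.
move=> z; apply: (@continuous_comp _ _ _ (fun z : R[i] => - 'i%C * z)).
  exact: mulc_continuous.
exact: Re_continuous.
Qed.

Lemma complex_complete (F : set_system R[i]) :
  ProperFilter F -> cauchy F -> cvg F.
Proof.
move=> FF /cauchyP Fc.
have parts (g : R[i] -> R) : (forall z w, `|g z - g w|%:C <= `|z - w|) ->
    cvg (g @ F).
  move=> glip; apply: R_complete; apply/cauchyP => e e0.
  have e0' : 0 < e%:C :> R[i] by rewrite ltcR.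
  have [z Fz] := Fc _ e0'; exists (g z).
  suff : F (g @^-1` ball (g z) e) by [].
  apply: filterS Fz => w; rewrite /preimage /= -!ball_normE /= => zw.
  by rewrite -ltcR; apply: le_lt_trans zw; exact: glip.
have /cvg_ex[/= a Fa] : cvg (@complex.Re R @ F).
  apply: parts => z w; apply: le_trans (normc_ge_Re _).
  by case: z w => [? ?] [? ?].
have /cvg_ex[/= b Fb] : cvg (@complex.Im R @ F).
  apply: parts => z w.
  have -> : `|z - w| = `|- 'i%C * (z - w)|.
    rewrite normrM normrN.
    by rewrite [X in X * _]normc_def /= expr0n expr1n add0r sqrtr1 mul1r.
  apply: le_trans (normc_ge_Re _).
  case: z w => [? ?] [? ?] /=.
  by rewrite oppr0 mul0r add0r mulN1r opprK.
apply/cvg_ex; exists (a%:C + 'i%C * b%:C).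
have -> : F = (fun z => (complex.Re z)%:C + 'i%C * (complex.Im z)%:C) @ F.
  apply/seteqP; split => A; rewrite /= /nbhs /=;
    by apply: filterS => z; rewrite /= -complexE.
apply: cvgD.
  by apply: cvg_comp Fa _; exact: real_complex_continuous.
apply: cvgM; first exact: cvg_cst.
by apply: cvg_comp Fb _; exact: real_complex_continuous.
Unshelve. all: by end_near. Qed.

Section Continuity.
Variable T : topologicalType.
Implicit Types u v : T -> R[i].

Lemma contcD u v : continuous u -> continuous v ->
  continuous (fun x => u x + v x).
Proof. by move=> cu cv x; apply: cvgD; [exact: cu | exact: cv]. Qed.

Lemma contcN u : continuous u -> continuous (fun x => - u x).
Proof. by move=> cu x; apply: cvgN; exact: cu. Qed.

Lemma contcM u v : continuous u -> continuous v ->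
  continuous (fun x => u x * v x).
Proof. by move=> cu cv x; apply: cvgM; [exact: cu | exact: cv]. Qed.

Lemma contc_cst (c : R[i]) : continuous (fun _ : T => c).
Proof. by move=> x; exact: cvg_cst. Qed.

Lemma contc_conj u : continuous u -> continuous (fun x => (u x)^*).
Proof.
move=> cu x; apply/cvgrPdist_lt => e e0.
move/cvgrPdist_lt : (cu x) => /(_ e e0); apply: filterS => y.
by rewrite -rmorphB normcJ.
Qed.

Lemma contc_norm u : continuous u -> continuous (fun x => complex.Re `|u x|).
Proof.
move=> cu x; apply: (@continuous_comp _ _ _ (fun x => `|u x|)).
  by apply: cvg_norm; exact: cu.
exact: Re_continuous.
Qed.

End Continuity.

Definition circle : set R[i] := [set z | `|z| = 1].

Lemma compact_circle : compact circle.
Proof.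
pose h (p : R * R) : R[i] := p.1%:C + 'i%C * p.2%:C.
have hc : continuous h.
  move=> p; apply: cvgD.
    by apply: cvg_comp (@cvg_fst _ _ _ _ _) _; exact: real_complex_continuous.
  apply: cvgM; first exact: cvg_cst.
  by apply: cvg_comp (@cvg_snd _ _ _ _ _) _; exact: real_complex_continuous.
apply: (@subclosed_compact _ _ (h @` (`[-1, 1] `*` `[-1, 1]))).
- have -> : circle = (fun z : R[i] => complex.Re `|z|) @^-1` [set x | x = 1].
    apply/seteqP; split => z; rewrite /circle /preimage /mkset.
      by move=> ->.
    by move=> z1; rewrite -(RRe_real (normr_real z)) z1.
  apply: closed_comp; last exact: closed_eq.
  move=> z _; have Fz := nbhs_filter z.
  apply: (@continuous_comp _ _ _ (fun z : R[i] => `|z|)).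
    by apply: cvg_norm; exact: cvg_id.
  exact: Re_continuous.
- apply: continuous_compact; first exact: continuous_subspaceT.
  by apply: compact_setX; exact: segment_compact.
- move=> [a b]; rewrite /circle /= normc_def /= => /eqP.
  rewrite -(rmorph1 (real_complex R)) (inj_eq (@complexI R)) => /eqP ab1.
  have {}ab1 : a ^+ 2 + b ^+ 2 = 1.
    rewrite -[LHS]sqr_sqrtr ?ab1 ?expr1n //.
    by rewrite addr_ge0 // sqr_ge0.
  exists (a, b); last by rewrite /h [RHS]complexE.
  split => /=; rewrite in_itv /= -ler_norml -sqrtr1 -sqrtr_sqr ler_sqrt //.
    by rewrite -ab1 lerDl sqr_ge0.
  by rewrite -ab1 lerDr sqr_ge0.
Qed.

End ComplexTopology.

Arguments circle : clear implicits.

(* C(T), with the sup norm. *)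
Definition Ccircle (R : realType) : Type := continuousType (circle R) R[i].

Section Ccircle.
Variable R : realType.
Local Notation CT := (Ccircle R).
Implicit Types f g h : CT.

HB.instance Definition _ := Choice.copy CT (continuousType (circle R) R[i]).

Definition CT_fun (f : CT) : circle R -> R[i] := Continuous.sort f.

Lemma CT_cont f : continuous (CT_fun f).
Proof. exact: (@cts_fun _ _ (f : continuousType (circle R) R[i])). Qed.

Arguments CT_cont : clear implicits.

Definition mkCT (u : circle R -> R[i]) (cu : continuous u) : CT := mkcts cu.

Lemma CT_eqP f g : CT_fun f =1 CT_fun g -> f = g.
Proof. by move=> fg; apply/continuousEP. Qed.

Definition CT_add f g := mkCT (contcD (CT_cont f) (CT_cont g)).
Definition CT_opp f := mkCT (contcN (CT_cont f)).
Definition CT_cst (c : R[i]) : CT := mkCT (@contc_cst R (circle R) c).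
Definition CT_mul f g := mkCT (contcM (CT_cont f) (CT_cont g)).
Definition CT_scale (c : R[i]) f := mkCT (contcM (@contc_cst R (circle R) c) (CT_cont f)).
Definition CT_star f := mkCT (contc_conj (CT_cont f)).

Lemma CT_addA : associative CT_add.
Proof. by move=> f g h; apply: CT_eqP => z; exact: addrA. Qed.
Lemma CT_addC : commutative CT_add.
Proof. by move=> f g; apply: CT_eqP => z; exact: addrC. Qed.
Lemma CT_add0 : left_id (CT_cst 0) CT_add.
Proof. by move=> f; apply: CT_eqP => z; exact: add0r. Qed.
Lemma CT_addN : left_inverse (CT_cst 0) CT_opp CT_add.
Proof. by move=> f; apply: CT_eqP => z; exact: addNr. Qed.

HB.instance Definition _ :=
  GRing.isZmodule.Build CT CT_addA CT_addC CT_add0 CT_addN.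

Lemma CT_scaleA (c d : R[i]) f : CT_scale c (CT_scale d f) = CT_scale (c * d) f.
Proof. by apply: CT_eqP => z; exact: mulrA. Qed.
Lemma CT_scale1 : left_id 1 CT_scale.
Proof. by move=> f; apply: CT_eqP => z; exact: mul1r. Qed.
Lemma CT_scaleDr : right_distributive CT_scale +%R.
Proof. by move=> c f g; apply: CT_eqP => z; exact: mulrDr. Qed.
Lemma CT_scaleDl f : {morph CT_scale^~ f : c d / c + d}.
Proof. by move=> c d; apply: CT_eqP => z; exact: mulrDl. Qed.

HB.instance Definition _ := GRing.Zmodule_isLmodule.Build R[i] CT
  CT_scaleA CT_scale1 CT_scaleDr CT_scaleDl.

Definition CT_norm f : R[i] :=
  (sup (range (fun z => complex.Re `|CT_fun f z|)))%:C.

Lemma CT_has_ubound f : has_ubound (range (fun z => complex.Re `|CT_fun f z|)).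
Proof.
have c0 := contc_norm (CT_cont f).
pose n z := complex.Re `|CT_fun f z|.
pose nL : R[i] -> R := 'valL_(0 : R) n.
have nLE z : nL (val z) = n z by rewrite -[in RHS](@valLK _ _ (0 : R) _ n).
have cnL : {within circle R, continuous nL}.
  by apply/(@subspace_valL_continuousP' _ (circle R) R 0 n).
have /compact_bounded[M [_ bM]] : compact (range n).
  suff -> : range n = nL @` circle R.
    exact: continuous_compact cnL (@compact_circle R).
  apply/seteqP; split => [_ [z _ <-]|_ [z Tz <-]].
    by exists (val z); [exact: set_valP | exact: nLE].
  by exists (exist _ z (mem_set Tz)) => //; rewrite -nLE.
exists (M + 1) => x xf; apply: le_trans (ler_norm x) _.
by apply: (bM (M + 1)) => //; rewrite ltrDl.
Qed.

Lemma CT_norm_ge f z : `|CT_fun f z| <= CT_norm f.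
Proof.
rewrite -(RRe_real (normr_real (CT_fun f z))) lecR.
by apply: ub_le_sup; [exact: CT_has_ubound | exists z].
Qed.

Definition circle1 : circle R :=
  exist _ (1 : R[i]) (mem_set (normr1 R[i] : circle R 1)).

Lemma CT_norm_le f (M : R[i]) : (forall z, `|CT_fun f z| <= M) -> CT_norm f <= M.
Proof.
move=> fM.
have M0 : 0 <= M by apply: le_trans (fM circle1).
rewrite -(RRe_real (ger0_real M0)) lecR; apply: ge_sup.
  by exists (complex.Re `|CT_fun f circle1|), circle1.
move=> _ [z _ <-]; rewrite -lecR (RRe_real (ger0_real M0)).
by rewrite (RRe_real (normr_real _)).
Qed.

Lemma CT_norm_ge0 f : 0 <= CT_norm f.
Proof. exact: le_trans (normr_ge0 _) (CT_norm_ge f circle1). Qed.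

Lemma CT_normD f g : CT_norm (f + g) <= CT_norm f + CT_norm g.
Proof.
apply: CT_norm_le => z; apply: le_trans (ler_normD _ _) _.
by apply: lerD; exact: CT_norm_ge.
Qed.

Lemma CT_normZ (c : R[i]) f : CT_norm (c *: f) = `|c| * CT_norm f.
Proof.
have le (d : R[i]) h : CT_norm (d *: h) <= `|d| * CT_norm h.
  apply: CT_norm_le => z; rewrite [`|_|](normrM d (CT_fun h z)).
  by rewrite ler_wpM2l // CT_norm_ge.
apply/eqP; rewrite eq_le le /=; have [->|c0] := eqVneq c 0.
  by rewrite normr0 mul0r CT_norm_ge0.
have := le c^-1 (c *: f).
by rewrite scalerA mulVf // scale1r normfV mulrC ler_pdivlMr ?normr_gt0 // mulrC.
Qed.

Lemma CT_norm0_eq0 f : CT_norm f = 0 -> f = 0.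
Proof.
move=> f0; apply: CT_eqP => z; apply/eqP; rewrite -normr_le0 -f0.
exact: CT_norm_ge.
Qed.

HB.instance Definition _ :=
  Lmodule_isNormed.Build R[i] CT CT_normD CT_normZ CT_norm0_eq0.

Lemma CT_complete (F : set_system CT) : ProperFilter F -> cauchy F -> cvg F.
Proof.
move=> FF /cauchyP Fc.
have evc (z : circle R) : exists l : R[i], (fun f => CT_fun f z) @ F --> l.
  apply/cvg_ex; apply: complex_complete; apply/cauchyP => e e0.
  have [f Ff] := Fc _ e0; exists (CT_fun f z).
  suff : F ((fun f => CT_fun f z) @^-1` ball (CT_fun f z) e) by [].
  apply: filterS Ff => g; rewrite /preimage /= -!ball_normE /= => fg.
  by apply: le_lt_trans fg; exact: (CT_norm_ge (f - g) z).
have [u ucvg] := choice evc.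
have uP (e : R[i]) f : 0 < e -> F (ball f e) ->
    forall z, `|CT_fun f z - u z| <= e.
  move=> e0 Ff z; apply/ler_addgt0Pr => d d0.
  have /cvgrPdist_lt /(_ _ d0) Fd := ucvg z.
  have [g [fg gu]] := filter_ex (filterI Ff Fd).
  rewrite -(subrKA (CT_fun g z)); apply: le_trans (ler_normD _ _) _.
  apply: lerD; last by rewrite distrC ltW.
  apply: le_trans (CT_norm_ge (f - g) z) _.
  by move: fg; rewrite -ball_normE /= => /ltW.
have uc : continuous u.
  move=> z; apply/(@cvgrPdist_lt _ _ _ _ (nbhs_filter z)) => e e0.
  have e3 : 0 < e / 3 by rewrite divr_gt0.
  have [f Ff] := Fc _ e3.
  have := CT_cont f z.
  move/(@cvgrPdist_lt _ _ _ _ (nbhs_filter z)) => /(_ _ e3).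
  apply: filterS => w fzw.
  rewrite -(subrKA (CT_fun f z)) -(subrKA (CT_fun f w) (CT_fun f z)).
  apply: le_lt_trans (ler_normD _ _) _.
  rewrite [ltRHS](_ : e = e / 3 + (e / 3 + e / 3)).
    apply: ler_ltD; first by rewrite distrC; exact: uP.
    apply: le_lt_trans (ler_normD _ _) _.
    by apply: ltr_leD => //; exact: uP.
  by field.
apply/cvg_ex; exists (mkCT uc); apply/cvgrPdist_lt => e e0.
have e2 : 0 < e / 2 by rewrite divr_gt0.
have [f Ff] := Fc _ e2.
apply: filterS (Ff) => g; rewrite -ball_normE /= => fg.
rewrite -(subrKA f) [e]splitr; apply: le_lt_trans (ler_normD _ _) _.
apply: ler_ltD => //; apply: CT_norm_le => z.
by rewrite -normrN opprB; exact: uP.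
Qed.

HB.instance Definition _ := Uniform_isComplete.Build CT CT_complete.

Lemma CT_mulA : associative CT_mul.
Proof. by move=> f g h; apply: CT_eqP => z; exact: mulrA. Qed.
Lemma CT_mul1l : left_id (CT_cst 1) CT_mul.
Proof. by move=> f; apply: CT_eqP => z; exact: mul1r. Qed.
Lemma CT_mul1r : right_id (CT_cst 1) CT_mul.
Proof. by move=> f; apply: CT_eqP => z; exact: mulr1. Qed.
Lemma CT_mulDl : left_distributive CT_mul +%R.
Proof. by move=> f g h; apply: CT_eqP => z; exact: mulrDl. Qed.
Lemma CT_mulDr : right_distributive CT_mul +%R.
Proof. by move=> f g h; apply: CT_eqP => z; exact: mulrDr. Qed.
Lemma CT_scaleAl (c : R[i]) f g : c *: CT_mul f g = CT_mul (c *: f) g.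
Proof. by apply: CT_eqP => z; exact: mulrA. Qed.
Lemma CT_scaleAr (c : R[i]) f g : c *: CT_mul f g = CT_mul f (c *: g).
Proof. by apply: CT_eqP => z; exact: mulrCA. Qed.
Lemma CT_starK : involutive CT_star.
Proof. by move=> f; apply: CT_eqP => z; exact: conjcK. Qed.
Lemma CT_starD : {morph CT_star : f g / f + g}.
Proof. by move=> f g; apply: CT_eqP => z; exact: (rmorphD conjc). Qed.
Lemma CT_starZ (c : R[i]) f : CT_star (c *: f) = c^* *: CT_star f.
Proof. by apply: CT_eqP => z; exact: (rmorphM conjc). Qed.
Lemma CT_starM f g : CT_star (CT_mul f g) = CT_mul (CT_star g) (CT_star f).
Proof.
by apply: CT_eqP => z; rewrite [LHS](rmorphM conjc); exact: mulrC.
Qed.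

Lemma CT_normM f g : `|CT_mul f g| <= `|f| * `|g|.
Proof.
apply: CT_norm_le => z; rewrite [`|_|](normrM (CT_fun f z) (CT_fun g z)).
by apply: ler_pM => //; exact: CT_norm_ge.
Qed.

Lemma CT_norm_star f : `|CT_mul (CT_star f) f| = `|f| ^+ 2.
Proof.
apply/eqP; rewrite eq_le; apply/andP; split.
  apply: CT_norm_le => z.
  rewrite [`|_|](normrM (CT_fun f z)^* (CT_fun f z)) normcJ -expr2.
  by rewrite ler_pXn2r ?nnegrE ?normr_ge0 //; exact: CT_norm_ge.
have s0 := normr_ge0 (CT_mul (CT_star f) f).
rewrite -[leRHS]sqrtCK ler_pXn2r ?nnegrE ?sqrtC_ge0 ?normr_ge0 //.
apply: CT_norm_le => z.
rewrite -(@ler_pXn2r _ 2) ?nnegrE ?sqrtC_ge0 ?normr_ge0 // sqrtCK.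
have := CT_norm_ge (CT_mul (CT_star f) f) z.
by rewrite [X in X <= _](normrM (CT_fun f z)^* (CT_fun f z)) normcJ -expr2.
Qed.

HB.instance Definition _ := isCStarAlgebra.Build R CT
  CT_mulA CT_mul1l CT_mul1r CT_mulDl CT_mulDr CT_scaleAl CT_scaleAr
  CT_starK CT_starD CT_starZ CT_starM CT_normM CT_norm_star.

HB.instance Definition _ := GRing.PzRing.copy CT (CT : cstarAlgType R).
End Ccircle.

Section ExelCrossedProduct.
Variable R : realType.
Implicit Types A C D E T : cstarAlgType R.

(* Not necessarily unital. *)
Definition is_star_hom A D (phi : A -> D) : Prop :=
  [/\ linear phi, {morph phi : x y / x * y} & {morph phi : x / star x}].

Definition cstar_isomorphic A D : Prop :=
  exists2 phi : A -> D, is_star_hom phi & bijective phi.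

Definition is_positive A (a : A) : Prop := exists x : A, a = star x * x.

Record exelSystem C := ExelSystem {
  exel_endo : C -> C;
  exel_transfer : C -> C;
  exel_endo_hom : is_star_hom exel_endo;
  exel_transfer_linear : linear exel_transfer;
  exel_transfer_pos : forall a, is_positive a -> is_positive (exel_transfer a);
  exel_transferP : forall f g,
    exel_transfer (exel_endo f * g) = f * exel_transfer g }.

Lemma is_star_hom_id A : is_star_hom (@id A).
Proof. by []. Qed.

Definition trivial_exel C : exelSystem C :=
  @ExelSystem C id id (@is_star_hom_id C)
    (fun _ _ _ => erefl) (fun _ h => h) (fun _ _ => erefl).

Definition lin_span A (X : set A) : set A :=
  [set v | exists n (c : 'I_n -> R[i]) (x : 'I_n -> A),
     (forall k, X (x k)) /\ v = \sum_(k < n) c k *: x k].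

Definition is_cstar_subalgebra A (Y : set A) : Prop :=
  [/\ closed Y, Y 1,
      forall (c : R[i]) x y, Y x -> Y y -> Y (c *: x + y),
      forall x y, Y x -> Y y -> Y (x * y)
    & forall x, Y x -> Y (star x)].

Definition is_closed_ideal A (J : set A) : Prop :=
  [/\ closed J, J 0,
      forall (c : R[i]) x y, J x -> J y -> J (c *: x + y)
    & forall a x, J x -> J (a * x) /\ J (x * a)].

Section Toeplitz.
Variables (C : cstarAlgType R) (X : exelSystem C).

Definition toeplitz_relations D (pi : C -> D) (V : D) : Prop :=
  [/\ is_star_hom pi, pi 1 = 1,
      forall f, V * pi f = pi (exel_endo X f) * V
    & forall f, pi (exel_transfer X f) = star V * pi f * V].

(* (T, i, S) is the universal unital C*-algebra for the Toeplitz relations;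
   the homomorphism given by universality is unique because i(C) and S
   generate T. *)
Definition is_toeplitz_algebra T (i : C -> T) (S : T) : Prop :=
  [/\ toeplitz_relations i S,
      smallest (@is_cstar_subalgebra T) (range i `|` [set S]) = setT
    & forall D (pi : C -> D) (V : D), toeplitz_relations pi V ->
        exists phi : T -> D,
          [/\ is_star_hom phi, phi 1 = 1, forall f, phi (i f) = pi f
            & phi S = V]].

Definition is_redundancy T (i : C -> T) (S : T) (f : C) (k : T) : Prop :=
  closure (lin_span [set x | exists a b, x = i a * S * star S * i b]) k /\
  forall g, i f * i g * S = k * i g * S.

Definition redundancy_ideal T (i : C -> T) (S : T) : set T :=
  smallest (@is_closed_ideal T)
    [set x | exists f k, is_redundancy i S f k /\ x = i f - k].

(* q presents E as the quotient T / J. *)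
Definition is_quotient T (J : set T) E (q : T -> E) : Prop :=
  [/\ is_star_hom q, forall y, exists x, q x = y
    & forall x, q x = 0 <-> J x].

Definition is_exel_crossed_product E : Prop :=
  exists (T : cstarAlgType R) (i : C -> T) (S : T) (q : T -> E),
    is_toeplitz_algebra i S /\ is_quotient (redundancy_ideal i S) q.

End Toeplitz.

Definition finite_dimensional A : Prop :=
  exists n (e : 'I_n -> A), forall a : A,
    exists c : 'I_n -> R[i], a = \sum_(k < n) c k *: e k.

Definition linearly_independent A n (a : 'I_n -> A) : Prop :=
  forall c : 'I_n -> R[i], \sum_(k < n) c k *: a k = 0 -> forall k, c k = 0.

(* D is the completion of the algebraic tensor product of A1 and A2 for some
   C*-norm: x (x) y |-> j1 x * j2 y induces a *-homomorphism from the algebraic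
   tensor product to D, which is injective and has dense range.  A tensor
   vanishes iff, written as a sum of a k (x) b k with linearly independent a k,
   all the b k are zero.  The C*-norm is unique when A1 or A2 is nuclear, in
   particular finite-dimensional or commutative. *)
Definition is_cstar_tensor A1 A2 D : Prop :=
  exists (j1 : A1 -> D) (j2 : A2 -> D),
    [/\ is_star_hom j1 /\ j1 1 = 1,
        is_star_hom j2 /\ j2 1 = 1,
        forall x y, j1 x * j2 y = j2 y * j1 x,
        forall n (a : 'I_n -> A1) (b : 'I_n -> A2),
          linearly_independent a ->
          \sum_(k < n) j1 (a k) * j2 (b k) = 0 -> forall k, b k = 0
      & closure (lin_span [set z | exists x y, z = j1 x * j2 y]) = setT].

End ExelCrossedProduct.

(* Main.v *)
Require Import Defs.
From mathcomp Require Import all_boot all_order all_algebra complex.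
From mathcomp Require Import all_classical all_reals all_analysis.
From mathcomp Require Import zify ring lra.

(* The redundancy (1, S S^* ) makes the image u of S in E a unitary commuting
   with the image of B.  By universality there is a *-homomorphism psi from E
   to D sending b to b (x) 1 and u to 1 (x) z; we show that psi is isometric
   with dense range.  Since x^* x is self-adjoint, ||x||^2 = ||(x^* x)^N||^(1/N)
   for N = 2^k, so that an estimate ||p|| <= n ||psi p|| for polynomials p of n
   terms in u suffices: the factor, linear in N, disappears in the limit.  That
   estimate follows from ||b_m|| <= ||\sum_l b_l (x) z^l||, i.e. a Fourier
   coefficient bound (averaging over roots of unity) for the values in B of the
   polynomial at the points of the circle.  Those values are bounded by the norm
   in D because ||b (x) g|| >= ||b|| whenever g = 1 on a nonempty open set: if
   g h = h <> 0 and b is self-adjoint then (b (x) g)^N (1 (x) h) = b^N (x) h, and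
   b |-> ||b (x) h|| is equivalent to the norm of the finite-dimensional B. *)

Set Implicit Arguments.
Unset Strict Implicit.
Unset Printing Implicit Defensive.

Import Order.TTheory GRing.Theory Num.Theory numFieldNormedType.Exports.

Local Open Scope classical_set_scope.
Local Open Scope ring_scope.
Local Open Scope complex_scope.

(** * Real-valued norms and *-homomorphisms *)

Section RealNorm.
Variables (R : realType) (V : normedModType R[i]).
Implicit Types x y : V.

(** Norms take values in [R[i]]; their real parts bring the estimates into the ordered field [R],
    where [lra] and [nra] apply. *)
Definition nrm x : R := complex.Re `|x|.

Lemma nrmE x : `|x| = (nrm x)%:C.
Proof. by rewrite /nrm RRe_real // normr_real. Qed.

Lemma nrm_ge0 x : 0 <= nrm x.
Proof. by rewrite -lecR -nrmE; exact: normr_ge0. Qed.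

Lemma nrmD x y : nrm (x + y) <= nrm x + nrm y.
Proof. by rewrite -lecR rmorphD /= -!nrmE ler_normD. Qed.

Lemma nrmN x : nrm (- x) = nrm x.
Proof. by rewrite /nrm normrN. Qed.

Lemma nrmB x y : nrm (x - y) <= nrm x + nrm y.
Proof. by rewrite -(nrmN y); exact: nrmD. Qed.

Lemma nrm_distC x y : nrm (x - y) = nrm (y - x).
Proof. by rewrite /nrm distrC. Qed.

Lemma nrm_dist_tri x y z : nrm (x - z) <= nrm (x - y) + nrm (y - z).
Proof. by rewrite -(subrKA y); exact: nrmD. Qed.

Lemma nrm0 : nrm 0 = 0.
Proof. by rewrite /nrm normr0. Qed.

Lemma nrm_le0 x : nrm x <= 0 -> x = 0.
Proof. by rewrite -lecR -nrmE => x0; apply/eqP; rewrite -normr_le0. Qed.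

Lemma nrmZ (c : R[i]) x : nrm (c *: x) = complex.Re `|c| * nrm x.
Proof.
by apply: (@complexI R); rewrite rmorphM /= -!nrmE normrZ; congr (_ * _).
Qed.

Lemma nrmZr (a : R) x : nrm (a%:C *: x) = `|a| * nrm x.
Proof. by rewrite nrmZ normc_real. Qed.

Lemma nrm_sum (I : Type) (r : seq I) (P : pred I) (F : I -> V) :
  nrm (\sum_(k <- r | P k) F k) <= \sum_(k <- r | P k) nrm (F k).
Proof.
elim/big_ind2: _ => [|x a y b xa yb|//]; first by rewrite nrm0.
by apply: le_trans (nrmD _ _) _; exact: lerD.
Qed.

Lemma nrm_limP x : (forall e, 0 < e -> nrm x <= e) -> x = 0.
Proof.
move=> xe; apply: nrm_le0; apply/ler_addgt0Pr => e e0.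
by rewrite add0r; exact: xe.
Qed.

Lemma ball_nrm x y (e : R) : ball x e%:C y <-> nrm (x - y) < e.
Proof. by rewrite -ball_normE /= nrmE ltcR. Qed.

Lemma nbhs_nrm x (e : R) : 0 < e -> nbhs x [set y | nrm (x - y) < e].
Proof.
move=> e0; have e0' : 0 < e%:C :> R[i] by rewrite ltcR.
by apply: filterS (nbhsx_ballx x _ e0') => y /ball_nrm.
Qed.

Lemma nbhs_nrmP x (U : set V) : nbhs x U ->
  exists2 e : R, 0 < e & forall y, nrm (x - y) < e -> U y.
Proof.
move=> /nbhs_ballP[_ /= /ltc0_real[e e0 ->] eU].
by exists e => // y xy; apply: eU; apply/ball_nrm.
Qed.

Lemma closure_nrm (X : set V) x : closure X x <->
  forall e, 0 < e -> exists2 y, X y & nrm (x - y) < e.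
Proof.
split=> [Xx e e0|Xx U /nbhs_nrmP[e e0 eU]].
  by have [y [Xy xy]] := Xx _ (nbhs_nrm x e0); exists y.
by have [y Xy xy] := Xx e e0; exists y; split=> //; exact: eU.
Qed.

Lemma closed_nrm (X : set V) : closed X <-> forall x,
  (forall e, 0 < e -> exists2 y, X y & nrm (x - y) < e) -> X x.
Proof.
split=> [cX x xX|cX x /closure_nrm]; last exact: cX.
by apply: cX; apply/closure_nrm.
Qed.

End RealNorm.

Lemma nrm_cauchy_cvg (R : realType) (V : completeNormedModType R[i])
    (w : nat -> V) :
  (forall e, 0 < e -> exists N, forall m n, (N <= m)%N -> (N <= n)%N ->
     nrm (w m - w n) < e) ->
  exists l, forall e, 0 < e -> exists N, forall n, (N <= n)%N ->
    nrm (w n - l) < e.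
Proof.
move=> wc.
have /cauchy_cvg : cauchy (w @ \oo).
  apply/cauchyP => _ /ltc0_real[e e0 ->]; have [N wN] := wc e e0.
  by exists (w N), N => // n /= Nn; apply/ball_nrm; exact: wN.
move=> /cvg_ex[l wl]; exists l => e e0.
have [N _ wN] := wl _ (nbhs_nrm l e0).
by exists N => n Nn; rewrite nrm_distC; exact: wN.
Qed.

Section CStarNorm.
Variables (R : realType) (A : cstarAlgType R).
Implicit Types x y z : A.

Lemma star0 : star 0 = 0 :> A.
Proof. by apply: (addIr (star 0)); rewrite -starD !add0r. Qed.

Lemma starN x : star (- x) = - star x.
Proof. by apply: (addIr (star x)); rewrite -starD !addNr star0. Qed.

Lemma starB x y : star (x - y) = star x - star y.
Proof. by rewrite starD starN. Qed.

Lemma star_mul x y : star (x * y) = star y * star x.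
Proof. exact: starM. Qed.

Lemma star1 : star 1 = 1 :> A.
Proof. by rewrite -[RHS]starK -[in RHS](mul1r (star 1)) star_mul starK mul1r. Qed.

Lemma starX x n : star (x ^+ n) = star x ^+ n.
Proof.
elim: n => [|n IH]; first by rewrite !expr0 star1.
by rewrite exprS star_mul IH exprSr.
Qed.

Lemma scale_mulAl (c : R[i]) x y : (c *: x) * y = c *: (x * y).
Proof. by rewrite -[LHS](cs_scaleAl c x y). Qed.

Lemma scale_mulAr (c : R[i]) x y : x * (c *: y) = c *: (x * y).
Proof. by rewrite -[LHS](cs_scaleAr c x y). Qed.

Lemma nrmM x y : nrm (x * y) <= nrm x * nrm y.
Proof. by rewrite -lecR rmorphM /= -!nrmE; exact: cs_normM. Qed.

Lemma nrm_starM x : nrm (star x * x) = nrm x ^+ 2.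
Proof. by apply: (@complexI R); rewrite rmorphXn /= -!nrmE; exact: cs_norm_star. Qed.

(** The C*-identity gives |z|^2 <= |star z| |z|, hence |z| <= |star z|; the same for [star z] gives
    the converse. *)
Lemma nrm_star x : nrm (star x) = nrm x.
Proof.
have le z : nrm z <= nrm (star z).
  have [->|z0] := eqVneq (nrm z) 0; first exact: nrm_ge0.
  have zp : 0 < nrm z by rewrite lt_def z0 nrm_ge0.
  by rewrite -(ler_pM2r zp) -expr2 -nrm_starM nrmM.
by apply/eqP; rewrite eq_le le -{2}(starK x) le.
Qed.

(** Only an inequality, since 1 has norm 0 in the zero algebra. *)
Lemma nrm_unit_le1 x : star x * x = 1 -> nrm x <= 1.
Proof.
move=> x1; have n11 : nrm (1 : A) <= 1.
  have := nrm_starM (1 : A); rewrite star1 mul1r => n1.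
  have := nrm_ge0 (1 : A); nra.
by rewrite -(@ler_pXn2r _ 2) ?nnegrE ?nrm_ge0 // -nrm_starM x1 expr1n.
Qed.

Lemma nrm1_le1 : nrm (1 : A) <= 1.
Proof. by apply: nrm_unit_le1; rewrite star1 mul1r. Qed.

Lemma nrmX x n : nrm (x ^+ n) <= nrm x ^+ n.
Proof.
elim: n => [|n IH]; first by rewrite !expr0 nrm1_le1.
rewrite !exprS; apply: le_trans (nrmM _ _) _.
by rewrite ler_wpM2l // nrm_ge0.
Qed.

Lemma nrm_selfadj_sqr x : star x = x -> nrm (x ^+ 2) = nrm x ^+ 2.
Proof. by move=> sx; rewrite expr2 -{1}sx nrm_starM. Qed.

(** The C*-identity controls squares, and the square of a self-adjoint element is self-adjoint;
    hence the exponents 2^k. *)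
Lemma nrm_selfadjX x k : star x = x -> nrm (x ^+ (2 ^ k)) = nrm x ^+ (2 ^ k).
Proof.
elim: k x => [|k IH] x sx; first by rewrite !expr1.
by rewrite expnS !exprM IH ?nrm_selfadj_sqr // starX sx.
Qed.

End CStarNorm.

Section StarHom.
Variables (R : realType) (A D : cstarAlgType R) (phi : A -> D).
Hypothesis hphi : is_star_hom phi.

Lemma star_homP (c : R[i]) x y : phi (c *: x + y) = c *: phi x + phi y.
Proof. by case: hphi => l _ _; exact: l. Qed.

Lemma star_homM x y : phi (x * y) = phi x * phi y.
Proof. by case: hphi. Qed.

Lemma star_hom_star x : phi (star x) = star (phi x).
Proof. by case: hphi. Qed.

Lemma star_homD x y : phi (x + y) = phi x + phi y.
Proof. by rewrite -[x in LHS]scale1r star_homP scale1r. Qed.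

Lemma star_hom0 : phi 0 = 0.
Proof. by apply: (addIr (phi 0)); rewrite -star_homD !add0r. Qed.

Lemma star_homZ (c : R[i]) x : phi (c *: x) = c *: phi x.
Proof. by rewrite -[c *: x]addr0 star_homP star_hom0 addr0. Qed.

Lemma star_homN x : phi (- x) = - phi x.
Proof. by rewrite -scaleN1r star_homZ scaleN1r. Qed.

Lemma star_homB x y : phi (x - y) = phi x - phi y.
Proof. by rewrite star_homD star_homN. Qed.

Lemma star_hom_sum (I : Type) (r : seq I) (P : pred I) (F : I -> A) :
  phi (\sum_(k <- r | P k) F k) = \sum_(k <- r | P k) phi (F k).
Proof. exact: (big_morph phi star_homD star_hom0). Qed.

Lemma star_homX x n : phi 1 = 1 -> phi (x ^+ n) = phi x ^+ n.
Proof.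
move=> p1; elim: n => [|n IH]; first by rewrite !expr0.
by rewrite !exprS star_homM IH.
Qed.

End StarHom.

(** * Square roots of self-adjoint elements *)

Lemma expr_lt_eventually (R : realType) (q e : R) : 0 <= q -> q < 1 -> 0 < e ->
  exists N, forall n, (N <= n)%N -> q ^+ n < e.
Proof.
move=> q0 q1 e0; have : `|q| < 1 by rewrite ger0_norm.
move=> /cvg_expr/cvgrPdist_lt/(_ _ e0)[N _ qN].
by exists N => n Nn; have := qN n Nn; rewrite sub0r normrN ger0_norm ?exprn_ge0.
Qed.

(* If c < a, writing a = c (1 + d), the squared Bernoulli inequality makes
   (a / c) ^ N at least (N d / 2) ^ 2, which outgrows K N. *)
Lemma le_of_expr_growth (R : realType) (a c K : R) : 0 <= a -> 0 <= c ->
  (forall k, a ^+ (2 ^ k) <= K * (2 ^ k)%:R * c ^+ (2 ^ k)) -> a <= c.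
Proof.
move=> a0 c0 ac; rewrite leNgt; apply/negP => ca.
have [c00|cn0] := eqVneq c 0.
  by have := ac 0; rewrite c00 !expr1 mulr0; lra.
have cp : 0 < c by rewrite lt_def cn0.
pose d := a / c - 1.
have d0 : 0 < d by rewrite subr_gt0 ltr_pdivlMr // mul1r.
have bern n : 1 + n%:R * d <= (1 + d) ^+ n.
  elim: n => [|n IH]; first by rewrite expr0 mul0r addr0.
  rewrite exprS -natr1; have n0 : 0 <= n%:R :> R by []; nra.
(* With N = 2^k, the hypothesis at k + 1 reads (1 + d)^(2N) <= 2KN. Squaring N d <= (1 + d)^N and
   cancelling one N bounds N. *)
have bound k : (2 ^ k)%:R * d ^+ 2 <= 2 * K.
  have := ac k.+1; rewrite -ler_pdivrMr ?exprn_gt0 // -expr_div_n.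
  have -> : a / c = 1 + d by rewrite /d addrC subrK.
  rewrite expnS mulnC exprM natrM.
  have := bern (2 ^ k)%N.
  have : 0 < (2 ^ k)%:R :> R by rewrite ltr0n expn_gt0.
  move: ((2 ^ k)%:R) ((1 + d) ^+ _) => N P N0 NP PK.
  have h : (N * d) ^+ 2 <= P ^+ 2 by rewrite ler_pXn2r ?nnegrE //; nra.
  have {}PK := le_trans h PK; rewrite -(ler_pM2l N0).
  by apply: le_trans (_ : K * (N * 2) <= _); nra.
pose M := 2 * K / d ^+ 2.
have d20 : 0 < d ^+ 2 by rewrite exprn_gt0.
have MN k : (2 ^ k)%:R <= M by rewrite ler_pdivlMr.
have M0 : 0 <= M by apply: le_trans (MN 0).
have := truncnS_gt M; set n := (Num.truncn M).+1 => Mn.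
have := MN n; rewrite leNgt => /negP; apply.
by apply: lt_trans Mn _; rewrite ltr_nat ltn_expl.
Qed.

Section SquareRoot.
Variables (R : realType) (A : cstarAlgType R).
Implicit Types x y z w : A.

Lemma addrr_scale2 x : x + x = (2 : R[i]) *: x.
Proof. by rewrite scaler_nat mulr2n. Qed.

Lemma nrm_half x : nrm ((2^-1 : R[i]) *: x) = nrm x / 2.
Proof.
have -> : (2^-1 : R[i]) = (2^-1)%:C by rewrite fmorphV rmorph_nat.
by rewrite nrmZr ger0_norm ?invr_ge0 // mulrC.
Qed.

Lemma sqr_sub_sqr x y : x * x - y * y = x * (x - y) + (x - y) * y.
Proof. by rewrite mulrBr mulrBl subrKA. Qed.

(* 1 - w is a square root of 1 - y when w = (y + w ^ 2) / 2, and this map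
   contracts the ball of radius `|y| < 1. *)
Lemma selfadj_sqrt y : star y = y -> nrm y < 1 ->
  exists s, [/\ star s = s, s * s = 1 - y
    & forall z, z * y = y * z -> z * s = s * z].
Proof.
move=> sy y1; pose q := nrm y; have q0 : 0 <= q := nrm_ge0 y.
have {}y1 : q < 1 by [].
pose F w := (2^-1 : R[i]) *: (y + w * w).
pose w n := iter n F 0.
have wS n : w n.+1 = F (w n) by [].
have wq n : nrm (w n) <= q.
  elim: n => [|n IH]; first by rewrite nrm0.
  rewrite wS nrm_half; have := nrmD y (w n * w n); rewrite -/q.
  have := nrmM (w n) (w n); have := nrm_ge0 (w n); nra.
have FB u v : nrm (F u - F v) <= (nrm u + nrm v) / 2 * nrm (u - v).
  have -> : F u - F v = (2^-1 : R[i]) *: (u * u - v * v).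
    by rewrite -scalerBr; congr (_ *: _); rewrite opprD addrACA subrr add0r.
  rewrite nrm_half sqr_sub_sqr.
  have := nrmD (u * (u - v)) ((u - v) * v).
  have := nrmM u (u - v); have := nrmM (u - v) v; lra.
have wd n : nrm (w n.+1 - w n) <= q ^+ n.+1.
  elim: n => [|n IH].
    by rewrite wS /F !mulr0 addr0 subr0 nrm_half expr1 -/q; lra.
  rewrite wS {2}wS; apply: le_trans (FB _ _) _; rewrite exprS.
  apply: ler_pM => //; [|exact: nrm_ge0|].
    by rewrite divr_ge0 // addr_ge0 ?nrm_ge0.
  by have := wq n.+1; have := wq n; lra.
(* Geometric tail of the telescoping sum, multiplied by 1 - q to avoid a division; the subtracted
   power lets the induction on p close. *)
have wc n p : (1 - q) * nrm (w (n + p)%N - w n) <= q ^+ n.+1 - q ^+ (n + p).+1.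
  elim: p => [|p IH]; first by rewrite addn0 !subrr nrm0 mulr0.
  rewrite addnS; have := nrm_dist_tri (w (n + p).+1) (w (n + p)%N) (w n).
  have := wd (n + p)%N; rewrite [q ^+ (n + p).+2]exprS.
  by have := exprn_ge0 (n + p).+1 q0; nra.
have {wc}wc n m : (n <= m)%N -> (1 - q) * nrm (w m - w n) <= q ^+ n.
  move=> /subnKC <-; apply: le_trans (wc _ _) _; rewrite exprS.
  by have := exprn_ge0 n q0; have := exprn_ge0 (n + (m - n)).+1 q0; nra.
have [l wl] : exists l, forall e, 0 < e -> exists N, forall n, (N <= n)%N ->
    nrm (w n - l) < e.
  apply: nrm_cauchy_cvg => e e0.
  have e1 : 0 < (1 - q) * e by rewrite mulr_gt0 // subr_gt0.
  have [N qN] := expr_lt_eventually q0 y1 e1; exists N => m n Nm Nn.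
  wlog nm : m n Nm Nn / (n <= m)%N.
    move=> H; have [/H|/ltnW/H] := leqP n m; first exact.
    by rewrite nrm_distC; exact.
  rewrite -(@ltr_pM2l _ (1 - q)) ?subr_gt0 //.
  by apply: le_lt_trans (wc _ _ nm) (qN _ Nn).
(* Each property of the limit l (self-adjointness, the fixed point equation, commutation with z) is
   the vanishing of an element estimated in this way. *)
have lim x (C : R) : 0 <= C ->
    (forall n, nrm x <= C * (nrm (w n - l) + nrm (w n.+1 - l))) -> x = 0.
  move=> C0 xC; apply: nrm_limP => e e0.
  have e1 : 0 < e / (2 * (C + 1)) by rewrite divr_gt0 //; lra.
  have [N wN] := wl _ e1; apply: le_trans (xC N) _.
  have := wN _ (leqnn N); have := wN _ (leqnSn N).
  rewrite !ltr_pdivlMr; try lra.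
  by have := nrm_ge0 (w N - l); have := nrm_ge0 (w N.+1 - l); nra.
have sw n : star (w n) = w n.
  elim: n => [|n IH]; first exact: star0.
  rewrite wS starZ starD star_mul IH sy; congr (_ *: _).
  by rewrite fmorphV rmorph_nat.
have sl : star l = l.
  apply/eqP; rewrite -subr_eq0; apply/eqP; apply: (lim _ 2) => // n.
  have -> : star l - l = (w n - l) - star (w n - l).
    by rewrite starB sw opprB [RHS]addrC addrA subrK.
  apply: le_trans (nrmB _ _) _; rewrite nrm_star.
  by have := nrm_ge0 (w n.+1 - l); lra.
have fl : l = F l.
  apply/eqP; rewrite -subr_eq0; apply/eqP; apply: (lim _ (1 + nrm l)).
    by have := nrm_ge0 l; lra.
  move=> n; have := nrm_dist_tri l (w n.+1) (F l).
  rewrite (nrm_distC l (w _)).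
  have : nrm (w n.+1 - F l) <= (nrm (w n) + nrm l) / 2 * nrm (w n - l).
    exact: FB.
  have := wq n; have := nrm_ge0 l.
  by have := nrm_ge0 (w n - l); have := nrm_ge0 (w n.+1 - l); nra.
exists (1 - l); split.
- by rewrite starB star1 sl.
- have ll : l + l = y + l * l.
    by rewrite addrr_scale2 {1}fl scalerA mulfV ?pnatr_eq0 // scale1r.
  rewrite mulrBl mul1r mulrBr mulr1 opprB addrA (addrAC 1) -addrA -opprD ll.
  by rewrite opprD [- y - _]addrC addrA addrK.
- move=> z zy; have zw n : z * w n = w n * z.
    elim: n => [|n IH]; first by rewrite mulr0 mul0r.
    rewrite wS scale_mulAr scale_mulAl mulrDr mulrDl zy.
    by rewrite mulrA IH -mulrA IH mulrA.
  suff zl : z * l = l * z by rewrite mulrBr mulrBl mulr1 mul1r zl.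
  apply/eqP; rewrite -subr_eq0; apply/eqP.
  apply: (lim _ (2 * nrm z)); first by rewrite mulr_ge0 ?nrm_ge0.
  move=> n; have -> : z * l - l * z = (w n - l) * z - z * (w n - l).
    by rewrite mulrBl mulrBr zw opprB [RHS]addrC addrA subrK.
  have := nrmB ((w n - l) * z) (z * (w n - l)).
  have := nrmM (w n - l) z; have := nrmM z (w n - l).
  by have := nrm_ge0 z; have := nrm_ge0 (w n.+1 - l); nra.
Qed.

End SquareRoot.

(* A self-adjoint x with `|x| < 1 is the real part of the unitary
   u = x + i sqrt (1 - x ^ 2), and the star homomorphism maps u to a partial
   isometry. *)
Lemma star_hom_contractive (R : realType) (A D : cstarAlgType R) (phi : A -> D) :
  is_star_hom phi -> forall x, nrm (phi x) <= nrm x.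
Proof.
move=> hphi.
have lt1 x : star x = x -> nrm x < 1 -> nrm (phi x) <= 1.
  move=> sx x1; have [||s [ss s2 sc]] := @selfadj_sqrt R A (x * x).
  - by rewrite star_mul sx.
  - by apply: le_lt_trans (nrmM _ _) _; have := nrm_ge0 x; nra.
  have {}sc : x * s = s * x by apply: sc; rewrite mulrA.
  pose i : R[i] := 'i%C; pose u := x + i *: s; pose v := x - i *: s.
  have su : star u = v.
    by rewrite starD starZ sx ss /i /v -scaleNr; congr (_ + _ *: _);
      apply/eqP; rewrite eq_complex /= oppr0 !eqxx.
  have vu : v * u = 1.
    have i2 : i * i = -1 by rewrite -expr2; exact: sqr_i.
    rewrite mulrDr !mulrBl !(scale_mulAl, scale_mulAr) sc scalerA i2 scaleN1r.
    by rewrite opprK s2 addrA subrK addrC subrK.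
  (* [phi] need not be unital: p is only a projection, still of norm at most 1, and it equals
     [star (phi u) * phi u]. *)
  pose p := phi 1.
  have pp : star p * p = p.
    by rewrite -(star_hom_star hphi) -(star_homM hphi) star1 mulr1.
  have p1 : nrm p <= 1.
    by have := nrm_starM p; rewrite pp; have := nrm_ge0 p; nra.
  have u1 : nrm (phi u) <= 1.
    have := nrm_starM (phi u).
    rewrite -(star_hom_star hphi) -(star_homM hphi) su vu -/p.
    by have := nrm_ge0 (phi u); nra.
  have xuv : phi x = (2^-1 : R[i]) *: (phi u + star (phi u)).
    rewrite -(star_hom_star hphi) su -(star_homD hphi) /u /v addrACA subrr addr0.
    by rewrite addrr_scale2 (star_homZ hphi) scalerA mulVf ?pnatr_eq0 // scale1r.
  rewrite xuv nrm_half; have := nrmD (phi u) (star (phi u)).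
  by rewrite nrm_star; lra.
(* Dividing by |x| + e brings x strictly inside the unit ball, also when x = 0. *)
have sa x : star x = x -> nrm (phi x) <= nrm x.
  move=> sx; apply/ler_addgt0Pr => e e0.
  have r0 : 0 < nrm x + e by have := nrm_ge0 x; lra.
  have := lt1 ((nrm x + e)^-1%:C *: x).
  rewrite (star_homZ hphi) !nrmZr ger0_norm; last by rewrite invr_ge0 ltW.
  rewrite ![_^-1 * _]mulrC ltr_pdivrMr // ler_pdivrMr // !mul1r ltrDl.
  apply=> //; rewrite starZ sx; congr (_ *: _); exact: conjc_real.
move=> x; rewrite -(@ler_pXn2r _ 2) ?nnegrE ?nrm_ge0 //.
rewrite -!nrm_starM -(star_hom_star hphi) -(star_homM hphi).
by apply: sa; rewrite star_mul starK.
Qed.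

(** * Norms on finite-dimensional spaces *)

Section BoundedBelow.
Variable R : realType.

Lemma coord_le_mx_norm m (a : 'rV[R]_m) j : `|a ord0 j| <= `|a|.
Proof.
rewrite [leRHS]/Num.norm /= mx_normrE; apply/bigmax_geP; right => /=.
by exists (ord0, j).
Qed.

(** By homogeneity it suffices to look at the unit sphere of R^m. It is compact, so the norm of the
    combination attains its minimum there, which is positive by independence. *)
Lemma independent_bounded_below (W : normedModType R[i]) m (w : 'I_m -> W) :
  (forall a : 'rV[R]_m, \sum_j (a ord0 j)%:C *: w j = 0 -> a = 0) ->
  exists2 c : R, 0 < c & forall (a : 'rV[R]_m),
    c * `|a| <= nrm (\sum_j (a ord0 j)%:C *: w j).
Proof.
move=> w_free; pose L (a : 'rV[R]_m) := \sum_j (a ord0 j)%:C *: w j.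
have LZ (t : R) a : L (t *: a) = t%:C *: L a.
  rewrite scaler_sumr; apply: eq_bigr => j _.
  by rewrite mxE rmorphM scalerA.
have LB a b : L (a - b) = L a - L b.
  rewrite -sumrB; apply: eq_bigr => j _.
  by rewrite !mxE rmorphB scalerBl.
have unit_vec (a : 'rV[R]_m) : a != 0 -> `| `|a|^-1 *: a | = 1.
  by move=> a0; rewrite normrZ normfV normr_id mulVf ?normr_eq0.
pose S : set 'rV[R]_m := [set a | `|a| = 1].
(* For m = 0 the sphere is empty and any positive constant serves. *)
have [S0|/set0P S0] := eqVneq S set0.
  exists 1 => // a; have [->|a0] := eqVneq a 0.
    by rewrite normr0 mulr0 nrm_ge0.
  by have : S (`|a|^-1 *: a) by [exact: unit_vec]; rewrite S0.
have cS : compact S.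
  apply: bounded_closed_compact.
    exists 1; split; first exact: num_real.
    by move=> M M1 a /= ->; exact: ltW.
  have -> : S = (fun a : 'rV[R]_m => `|a|) @^-1` [set x | x = 1] by [].
  by apply: closed_comp; [move=> a _; exact: norm_continuous | exact: closed_eq].
have cL : continuous (fun a => nrm (L a)).
  pose C := \sum_j nrm (w j).
  have C0 : 0 <= C by apply: sumr_ge0 => j _; exact: nrm_ge0.
  have LC a : nrm (L a) <= C * `|a|.
    apply: le_trans (nrm_sum _ _ _) _; rewrite mulr_suml; apply: ler_sum => j _.
    by rewrite nrmZr mulrC ler_wpM2l ?nrm_ge0 ?coord_le_mx_norm.
  move=> a; apply/(@cvgrPdist_lt _ _ _ _ (nbhs_filter a)) => e e0.
  have d0 : 0 < e / (C + 1) by rewrite divr_gt0 //; lra.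
  apply: (@filterS _ _ (nbhs_filter a) _ _ _ (nbhsx_ballx a _ d0)) => b.
  rewrite -ball_normE /= ltr_pdivlMr; last lra.
  move=> ab; apply: (@le_lt_trans _ _ (C * `|a - b|)).
    apply: le_trans (LC _); rewrite LB ler_norml.
    have := nrm_dist_tri (L a) (L b) 0; have := nrm_dist_tri (L b) (L a) 0.
    by rewrite !subr0 (nrm_distC (L b)); lra.
  by have := normr_ge0 (a - b); lra.
have [a Sa amin] := compact_EVT_min S0 cS (continuous_subspaceT cL).
have La0 : 0 < nrm (L a).
  rewrite lt_def nrm_ge0 andbT; apply/eqP => La; have : L a = 0.
    by apply: nrm_le0; rewrite La.
  move=> /w_free a0; move: Sa; rewrite inE /S /= a0 normr0 => /eqP.
  by rewrite eq_sym oner_eq0.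
exists (nrm (L a)) => // b; have [->|b0] := eqVneq b 0.
  by rewrite normr0 mulr0 nrm_ge0.
have := amin (`|b|^-1 *: b); rewrite LZ nrmZr ger0_norm ?invr_ge0 //.
rewrite inE => /(_ (unit_vec _ b0)).
by rewrite ler_pdivlMl ?normr_gt0 // mulrC.
Qed.

Lemma spanning_independent (V : normedModType R[i]) n (e : 'I_n -> V) :
  (forall v, exists c : 'I_n -> R[i], v = \sum_k c k *: e k) ->
  exists m (f : 'I_m -> V),
    (forall v, exists c : 'I_m -> R[i], v = \sum_k c k *: f k) /\
    (forall c : 'I_m -> R[i], \sum_k c k *: f k = 0 -> forall k, c k = 0).
Proof.
elim: n e => [|n IH] e span_e; first by exists 0, e; split=> // c _ [].
have [free_e|] := pselect (forall c : 'I_n.+1 -> R[i],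
    \sum_k c k *: e k = 0 -> forall k, c k = 0); first by exists n.+1, e.
move=> /existsNP[c /not_implyP[c0 /existsNP[k /eqP ck]]].
apply: (IH (e \o lift k)) => v; have [d ->] := span_e v.
exists (fun j => d (lift k j) - d k / c k * c (lift k j)).
move/eqP: c0; rewrite !(bigD1_ord k) //= addr_eq0 => /eqP ek.
have {}ek : e k = - ((c k)^-1 *: \sum_j c (lift k j) *: e (lift k j)).
  by rewrite -[e k](scalerK ck) ek scalerN.
rewrite {1}ek scalerN scalerA addrC scaler_sumr -sumrB.
by apply: eq_bigr => j _; rewrite scalerBl scalerA.
Qed.

Lemma finite_dim_bounded_below (V W : normedModType R[i]) (Phi : V -> W)
    n (e : 'I_n -> V) :
  linear Phi -> (forall v, Phi v = 0 -> v = 0) ->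
  (forall v, exists c : 'I_n -> R[i], v = \sum_k c k *: e k) ->
  exists2 c : R, 0 < c & forall v, c * nrm v <= nrm (Phi v).
Proof.
move=> linPhi injPhi /spanning_independent[m [f [span_f free_f]]].
have PhiD u v : Phi (u + v) = Phi u + Phi v.
  by rewrite -[u in LHS]scale1r linPhi scale1r.
have Phi0 : Phi 0 = 0 by apply: (addIr (Phi 0)); rewrite -PhiD !add0r.
have PhiZ c v : Phi (c *: v) = c *: Phi v.
  by rewrite -[c *: v]addr0 linPhi Phi0 addr0.
(* The complex basis f becomes the real basis f, i f, whose image under [Phi] is independent over
   the reals. *)
pose w (j : 'I_(m + m)) : V :=
  match fintype.split j with inl k => f k | inr k => 'i%C *: f k end.
have sumE (a : 'rV[R]_(m + m)) : \sum_j (a ord0 j)%:C *: w j =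
    \sum_k ((a ord0 (lshift m k))%:C + 'i%C * (a ord0 (rshift m k))%:C) *: f k.
  rewrite big_split_ord /= -big_split; apply: eq_bigr => k _ /=.
  rewrite /w (unsplitK (inl k : 'I_m + 'I_m)) (unsplitK (inr k : 'I_m + 'I_m)).
  by rewrite scalerDl scalerA mulrC.
have [a|c c0 cP] := @independent_bounded_below W _ (fun j => Phi (w j)).
  have -> : \sum_j (a ord0 j)%:C *: Phi (w j) = Phi (\sum_j (a ord0 j)%:C *: w j).
    rewrite (big_morph Phi PhiD Phi0); apply: eq_bigr => j _.
    by rewrite PhiZ.
  move=> /injPhi; rewrite sumE => /free_f a0; apply/rowP => j; rewrite mxE.
  case: (fintype.splitP j) => k jk; have /eqP := a0 k; rewrite eq_complex /=.
    have -> : j = lshift m k by apply: val_inj.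
    by rewrite !(mul0r, mul1r, subr0, addr0, add0r) => /andP[/eqP].
  have -> : j = rshift m k by apply: val_inj.
  by rewrite !(mul0r, mul1r, subr0, addr0, add0r) => /andP[_ /eqP].
(* C bounds |v| by C times its largest real coordinate; the 1 keeps C positive for an empty
   basis. *)
pose C := \sum_j nrm (w j) + 1.
have C0 : 0 < C by rewrite ltr_wpDl // sumr_ge0 // => j _; exact: nrm_ge0.
exists (c / C); first by rewrite divr_gt0.
move=> v; have [d vd] := span_f v.
pose a : 'rV[R]_(m + m) :=
  row_mx (\row_k complex.Re (d k)) (\row_k complex.Im (d k)).
have va : v = \sum_j (a ord0 j)%:C *: w j.
  rewrite sumE vd; apply: eq_bigr => k _; rewrite row_mxEl row_mxEr !mxE.
  by rewrite -complexE.
have Phiv : Phi v = \sum_j (a ord0 j)%:C *: Phi (w j).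
  by rewrite va (big_morph Phi PhiD Phi0); apply: eq_bigr => j _; rewrite PhiZ.
rewrite Phiv; apply: le_trans (cP a); rewrite mulrAC ler_pdivrMr // -mulrA.
rewrite ler_pM2l // va; apply: le_trans (nrm_sum _ _ _) _.
rewrite mulrDr mulr1 -[leLHS]addr0 lerD // mulr_sumr; apply: ler_sum => j _.
by rewrite nrmZr ler_wpM2r ?nrm_ge0 ?coord_le_mx_norm.
Qed.

End BoundedBelow.

(** * Fourier coefficients *)

Section RootsOfUnity.
Variable R : realType.

Lemma expr_eq1_norm (z : R[i]) n : (0 < n)%N -> z ^+ n = 1 -> `|z| = 1.
Proof.
move=> n0 zn; apply/eqP; rewrite -(@pexpr_eq1 _ _ n) ?normr_ge0 //.
by rewrite -normrX zn normr1.
Qed.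

Lemma sum_expr_root n (x : R[i]) : x ^+ n = 1 ->
  \sum_(j < n) x ^+ j = if x == 1 then n%:R else 0.
Proof.
move=> xn; case: eqP => [->|/eqP x1].
  by under eq_bigr do rewrite expr1n; rewrite sumr_const card_ord.
have := subrX1 x n; rewrite xn subrr => /esym/eqP.
by rewrite mulf_eq0 subr_eq0 (negPf x1) => /eqP.
Qed.

(** Iterated square roots of -1 give w with w^(2^k) = -1. Its order divides 2^(k+1) but not 2^k. *)
Lemma pow2_prim_root k : exists w : R[i], (2 ^ k).-primitive_root w.
Proof.
case: k => [|k].
  have [m mP] := prim_order_exists (isT : 0 < 1)%N (expr1 (1 : R[i])).
  by rewrite dvdn1 => /eqP m1; exists 1; rewrite m1 in mP.
have [w wk] : exists w : R[i], w ^+ (2 ^ k) = -1.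
  elim: k => [|k [w wk]]; first by exists (-1).
  by exists (sqrtC w); rewrite expnS exprM sqrtCK.
exists w; have w1 : w ^+ (2 ^ k.+1) = 1 by rewrite expnSr exprM wk sqrrN expr1n.
have [m mw] := prim_order_exists (expn_gt0 2 k.+1) w1.
move=> /(dvdn_pfactor _ _ (isT : prime 2))[j jk mj].
rewrite mj in mw; have [<- //|jk'] := eqVneq j k.+1.
have {}jk : (j <= k)%N by rewrite -ltnS ltn_neqAle jk' jk.
have : w ^+ (2 ^ k) = 1.
  by rewrite -(subnKC jk) expnD exprM (prim_expr_order mw) expr1n.
rewrite wk => /eqP; rewrite eq_sym -subr_eq0 opprK => /eqP h.
by have := @ltr0n R[i] 2; rewrite mulrS h ltxx.
Qed.

(** Exponents below n are distinct modulo N = 2^n > n, so by orthogonality the average of z^(-m)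
    times the polynomial over the N-th roots of unity is [c m]. *)
Lemma fourier_coef_le (V : normedModType R[i]) n (c : nat -> V) (M : R) :
  (forall z : R[i], `|z| = 1 -> nrm (\sum_(l < n) z ^+ l *: c l) <= M) ->
  forall m, (m < n)%N -> nrm (c m) <= M.
Proof.
move=> cM m mn; have [w wP] := pow2_prim_root n; set N := (2 ^ n)%N in wP.
have nN : (n < N)%N by rewrite ltn_expl.
have N0 : (0 < N)%N by rewrite expn_gt0.
have w1 := expr_eq1_norm N0 (prim_expr_order wP).
have w0 : w != 0 by rewrite -normr_gt0 w1.
have sumE : \sum_(j < N) (w ^+ m) ^- j *: \sum_(l < n) (w ^+ j) ^+ l *: c l =
    N%:R *: c m.
  under eq_bigr do rewrite scaler_sumr.
  rewrite exchange_big /= (bigD1 (Ordinal mn)) //= [X in _ + X]big1 ?addr0.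
    under eq_bigr do rewrite scalerA exprAC mulVf ?expf_neq0 // scale1r.
    by rewrite sumr_const card_ord scaler_nat.
  move=> l lm; under eq_bigr => j _ do rewrite scalerA (exprAC w j) -exprVn -exprMn.
  rewrite -scaler_suml sum_expr_root; last first.
    rewrite exprMn exprVn exprAC (prim_expr_order wP) expr1n invr1 mul1r.
    by rewrite exprAC (prim_expr_order wP) expr1n.
  rewrite -(inj_eq (mulfI (expf_neq0 m w0))) mulVKf ?expf_neq0 // mulr1.
  rewrite (eq_prim_root_expr wP) !modn_small ?(ltn_trans (ltn_ord _) nN) //.
    by rewrite (negPf (_ : l != m :> nat)) ?scale0r.
  exact: ltn_trans mn nN.
have N0R : 0 < N%:R :> R by rewrite ltr0n.
rewrite -(ler_pM2l N0R); have -> : N%:R * nrm (c m) = nrm (N%:R *: c m : V).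
  by rewrite -(rmorph_nat (real_complex R)) nrmZr ger0_norm ?ltW.
rewrite -sumE; apply: le_trans (nrm_sum _ _ _) _.
apply: le_trans (_ : \sum_(j < N) M <= _); last first.
  by rewrite sumr_const card_ord mulr_natl.
apply: ler_sum => j _; rewrite nrmZ normfV !normrX w1 !expr1n invr1 mul1r.
by apply: cM; rewrite normrX w1 expr1n.
Qed.

End RootsOfUnity.

(** * Continuous functions on the circle *)

Section CircleFunctions.
Variable R : realType.
Local Notation CT := (Ccircle R).
Implicit Types (f g h : CT) (s t : circle R).

Definition cval t : R[i] := set_val t.

Lemma cval_continuous : continuous cval.
Proof. exact: initial_continuous. Qed.

Lemma circle_norm t : `|cval t| = 1 :> R[i].
Proof. exact: set_valP t. Qed.

Lemma CT_fun_sum (I : Type) (r : seq I) (P : pred I) (F : I -> CT) t :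
  CT_fun (\sum_(k <- r | P k) F k) t = \sum_(k <- r | P k) CT_fun (F k) t.
Proof. by elim/big_rec2: _ => // k y x _ <-. Qed.

Lemma CT_funM f g t : CT_fun (f * g) t = CT_fun f t * CT_fun g t.
Proof. by []. Qed.

Lemma CT_funX f n t : CT_fun (f ^+ n) t = CT_fun f t ^+ n.
Proof. by elim: n => [|n IH]; rewrite ?expr0 // !exprS CT_funM IH. Qed.

Lemma CT_nrm_ge f t : nrm (CT_fun f t) <= nrm f.
Proof. by rewrite -lecR -!nrmE; exact: CT_norm_ge. Qed.

Lemma CT_nrm_le f (M : R) : (forall t, nrm (CT_fun f t) <= M) -> nrm f <= M.
Proof.
by move=> fM; rewrite -lecR -nrmE; apply: CT_norm_le => t; rewrite nrmE lecR.
Qed.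

Definition CT_id : CT := mkCT cval_continuous.

Lemma CT_id_unitary : star CT_id * CT_id = 1 /\ CT_id * star CT_id = 1.
Proof.
have id1 t : `|cval t : R[i]| ^+ 2 = 1 by rewrite circle_norm expr1n.
split; apply: CT_eqP => t; have := id1 t; rewrite normCK.
  by rewrite mulrC.
by [].
Qed.

Lemma circle_nbhs t (U : set (circle R)) : nbhs t U ->
  exists2 d : R, 0 < d &
    forall s, nrm (cval t - cval s) < d -> U s.
Proof.
case=> _ [[W oW <-] /= Wt WU].
have /nbhs_nrmP[d d0 dW] : nbhs (cval t) W by exact: open_nbhs_nbhs.
by exists d => // s /dW Ws; apply: WU.
Qed.

(** Heine's theorem: if d serves at r for e / 2, then d / 2 serves for e at every centre within d /
    2 of r, and compactness makes finitely many r enough. *)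
Lemma CT_unif_continuous f (e : R) : 0 < e -> exists2 d : R, 0 < d &
  forall s t, nrm (cval s - cval t) < d ->
    nrm (CT_fun f s - CT_fun f t) < e.
Proof.
move=> e0; have e2 : 0 < e / 2 by rewrite divr_gt0.
have cover := (compact_near_coveringP _).1 (@compact_circle R).
(* Compactness concerns the circle as a subset of [R[i]], so P is stated for complex x and reaches
   the subtype through [cval s = x]. *)
pose P (d : R) (x : R[i]) := forall s t, cval s = x ->
  nrm (cval s - cval t) < d -> nrm (CT_fun f s - CT_fun f t) < e.
have : \forall d \near 0^'+, circle R `<=` P d.
  apply: cover => x Tx; pose r : circle R := exist _ x (mem_set Tx).
  have := @CT_cont R f r _ (nbhs_nrm _ e2) => /circle_nbhs[d d0 dr].
  have d2 : 0 < d / 2 by rewrite divr_gt0.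
  exists ([set y | nrm (x - y) < d / 2], [set a | a < d / 2]).
    by split; [exact: nbhs_nrm | exact: nbhs_right_lt].
  move=> [y a] /= [xy ad] s t sy st.
  have xs : nrm (cval r - cval s) < d / 2 by rewrite sy.
  have rs : nrm (CT_fun f r - CT_fun f s) < e / 2.
    by apply: dr; apply: lt_trans xs _; lra.
  have rt : nrm (CT_fun f r - CT_fun f t) < e / 2.
    apply: dr; apply: le_lt_trans (nrm_dist_tri _ (cval s) _) _.
    by rewrite [d]splitr; exact: ltrD xs (lt_trans st ad).
  have := nrm_dist_tri (CT_fun f s) (CT_fun f r) (CT_fun f t).
  by rewrite (nrm_distC (CT_fun f s) (CT_fun f r)); lra.
move=> /(@filterI _ _ _ _ _ (nbhs_right_gt 0))/filter_ex[d [/= d0 dP]].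
by exists d => // s t; apply: dP => //; exact: circle_norm.
Qed.

Definition CT_abs f : CT :=
  mkCT (fun t => cvg_norm (@CT_cont R f t) : (fun s => `|CT_fun f s|) @ t --> _).

End CircleFunctions.

(** * Generation of C(T) by the coordinate function *)

(** The mass of the averaging kernel is proportional to C(2n, n) / 4^n. It thus decays no faster
    than 1 / (2n + 1), whereas the kernel away from its peak decays geometrically. *)
Lemma central_bin_ge n : (4 ^ n <= n.*2.+1 * 'C(n.*2, n))%N.
Proof.
elim: n => [|n IH]; first by rewrite bin0.
have e1 := mul_bin_diag n.*2.+2 n; have e2 := mul_bin_down n.*2.+1 n.
rewrite /= in e1 e2; rewrite -(leq_pmul2l (ltn0Sn n)) expnS doubleS.
have {}e2 : (n.*2.+1 * 'C(n.*2, n) = n.+1 * 'C(n.*2.+1, n))%N.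
  by rewrite e2 -addnn -addSn addnK.
move: IH; rewrite e2 => IH.
have {}e1 : ('C(n.*2.+2, n.+1) = 2 * 'C(n.*2.+1, n))%N.
  by apply/eqP; rewrite -(eqn_pmul2l (ltn0Sn n)) -e1; apply/eqP; nia.
rewrite e1; move: ('C(n.*2.+1, n)) (4 ^ n)%N IH => C F IH; nia.
Qed.

Section Density.
Variable R : realType.
Local Notation CT := (Ccircle R).
Implicit Types (f : CT) (s t p : circle R).

(** With s = z / w^j the summand is s^(-n) (1 + s)^(2n), a Laurent polynomial with exponents between
    -n and n. As 2n < N, the sum over j keeps only its constant term, the central binomial
    coefficient. *)
Lemma sum_binomial_kernel n N (w z : R[i]) :
  N.-primitive_root w -> (n.*2 < N)%N -> z != 0 ->
  \sum_(j < N) ((1 + z / w ^+ j) * (1 + (z / w ^+ j)^-1)) ^+ n =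
    (N * 'C(n.*2, n))%:R.
Proof.
move=> wP nN z0.
have N0 := prim_order_gt0 wP.
have w0 : w != 0 by rewrite -normr_gt0 (expr_eq1_norm N0 (prim_expr_order wP)).
have sE j : ((1 + z / w ^+ j) * (1 + (z / w ^+ j)^-1)) ^+ n =
    \sum_(l < n.*2.+1) (z ^+ l / z ^+ n *+ 'C(n.*2, l)) * (w ^+ n / w ^+ l) ^+ j.
  set s := z / w ^+ j; have s0 : s != 0 by rewrite mulf_neq0 ?invr_neq0 ?expf_neq0.
  have -> : (1 + s) * (1 + s^-1) = s^-1 * (s + 1) ^+ 2.
    by field.
  rewrite exprMn -exprM mul2n exprD1n mulr_sumr; apply: eq_bigr => l _.
  rewrite mulrnAr mulrnAl; congr (_ *+ _).
  have sX k : s ^+ k = z ^+ k / (w ^+ k) ^+ j by rewrite expr_div_n exprAC.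
  rewrite exprVn !sX expr_div_n; field.
  by rewrite !expf_neq0.
under eq_bigr do rewrite sE.
rewrite exchange_big /=.
have nn : (n < n.*2.+1)%N by rewrite ltnS -addnn leq_addr.
rewrite (bigD1 (Ordinal nn)) //= [X in _ + X]big1 ?addr0.
  rewrite !divff ?expf_neq0 //; under eq_bigr do rewrite expr1n mulr1.
  by rewrite sumr_const card_ord -mulrnA mulnC.
move=> l ln; rewrite -mulr_sumr sum_expr_root; last first.
  by rewrite expr_div_n !(exprAC w _ N) (prim_expr_order wP) !expr1n divr1.
rewrite -(inj_eq (mulIf (expf_neq0 l w0))) divfK ?expf_neq0 // mul1r.
rewrite (eq_prim_root_expr wP) !modn_small; last first.
- by apply: leq_ltn_trans nN; rewrite -addnn leq_addr.
- by apply: leq_ltn_trans nN; rewrite -ltnS; exact: ltn_ord.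
have -> : (n == l) = false by rewrite eq_sym; apply: negbTE.
by rewrite mulr0.
Qed.

(** The function t |-> |1 + t / p|^2 / 4 = 1 - |p - t|^2 / 4, with peak value 1 at p, written as an
    element of the *-algebra generated by the coordinate function. *)
Definition circle_kernel p : CT :=
  (4^-1 : R[i]) *: ((1 + (cval p)^-1 *: CT_id R)
    * star (1 + (cval p)^-1 *: CT_id R)).

Lemma sqr_norm_conjc (z : R[i]) : `|z| ^+ 2 = z * z^*.
Proof. exact: normCK. Qed.

Lemma circle_neq0 t : cval t != 0 :> R[i].
Proof. by rewrite -normr_gt0 circle_norm. Qed.

Lemma circle_conj t : (cval t)^* = (cval t)^-1.
Proof.
have := circle_norm t; move: (cval t) (circle_neq0 t) => z z0 z1.
apply: (mulfI z0); rewrite divff //; have := normCK z.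
by rewrite z1 expr1n.
Qed.

Lemma circle_kernel_fun p t : CT_fun (circle_kernel p) t =
  4^-1 * ((1 + cval t / cval p) * (1 + (cval t / cval p)^-1)).
Proof.
have -> : CT_fun (circle_kernel p) t =
    4^-1 * ((1 + (cval p)^-1 * cval t)
     * (1 + (cval p)^-1 * cval t)^*) by [].
rewrite (rmorphD conjc) (rmorph1 conjc) (rmorphM conjc) (fmorphV conjc) /=.
rewrite !circle_conj invrK invfM invrK.
by rewrite (mulrC (cval p)^-1) (mulrC (cval p)).
Qed.

Lemma circle_kernelE p t : CT_fun (circle_kernel p) t =
  (1 - nrm (cval p - cval t) ^+ 2 / 4)%:C.
Proof.
rewrite circle_kernel_fun rmorphB rmorphM rmorphXn /= -nrmE fmorphV !rmorph_nat.
rewrite sqr_norm_conjc (rmorphB conjc) /= !circle_conj.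
have := circle_neq0 t; have := circle_neq0 p.
by move: (cval t) (cval p) => x y y0 x0; field; rewrite x0 y0.
Qed.

(* Fejer-type averaging: p |-> (1 - |p - t| ^ 2 / 4) ^ n is a peaked kernel
   whose sum over the N-th roots of unity is independent of t. *)
Lemma CT_subalgebra_full (Y : set CT) :
  is_cstar_subalgebra Y -> Y (CT_id R) -> forall f, Y f.
Proof.
move=> [cY Y1 YP YM Ys] Yid f.
have Y0 : Y 0 by have := YP (-1) 1 1 Y1 Y1; rewrite scaleN1r addNr.
have YZ (c : R[i]) x : Y x -> Y (c *: x).
  by move=> Yx; rewrite -[_ *: _]addr0; exact: YP.
have YD x y : Y x -> Y y -> Y (x + y).
  by move=> Yx Yy; rewrite -[x]scale1r; exact: YP.
have YX x n : Y x -> Y (x ^+ n).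
  by move=> Yx; elim: n => [|n IH] //; rewrite exprS; exact: YM.
have Yker p : Y (circle_kernel p).
  have Y1id : Y (1 + (cval p)^-1 *: CT_id R) by apply: YD => //; exact: YZ.
  by apply: YZ; apply: YM => //; exact: Ys.
apply/(closed_nrm Y).1 => // e e0; pose M := nrm f.
have M0 : 0 <= M := nrm_ge0 f.
have e2 : 0 < e / 2 by rewrite divr_gt0.
have [d0 d00 fd0] := CT_unif_continuous f e2.
(* Capping d at 1 keeps q, the bound for the kernel at distance at least d from its peak,
   nonnegative. *)
pose d := Num.min d0 1; have dp : 0 < d by rewrite lt_min d00 ltr01.
have d1 : d <= 1 by rewrite ge_min lexx orbT.
have fd s t : nrm (cval s - cval t) < d ->
    nrm (CT_fun f s - CT_fun f t) <= e / 2.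
  by rewrite lt_min => /andP[st _]; exact/ltW/fd0.
pose q := 1 - d ^+ 2 / 4.
have q0 : 0 <= q by rewrite /q; nra.
have q1 : q < 1 by have : 0 < d ^+ 2 by [rewrite exprn_gt0]; rewrite /q; lra.
(* Otherwise 1 is at most a constant times 2^k q^(2^k) for all k, which forces 1 <= q. The 3 comes
   from 2N + 1 <= 3N for N >= 1. *)
have [n nP] : exists n, 2 * M * (n.*2.+1)%:R * q ^+ n < e / 2.
  apply/not_existsP => H; have : 1 <= q.
    apply: (@le_of_expr_growth _ _ _ (2 * M * 3 / (e / 2))) => // k.
    rewrite expr1n; set X := leRHS.
    have -> : X = 2 * M * (3 * 2 ^ k)%:R * q ^+ (2 ^ k) / (e / 2).
      by rewrite /X natrM; ring.
    rewrite ler_pdivlMr // mul1r; have /negP := H (2 ^ k)%N.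
    rewrite -leNgt => /le_trans; apply; rewrite ler_wpM2r ?exprn_ge0 //.
    by rewrite ler_wpM2l ?mulr_ge0 // ler_nat; have := expn_gt0 2 k; lia.
  by rewrite leNgt q1.
have [w wP] := pow2_prim_root R n.*2; set N := (2 ^ n.*2)%N in wP.
have nN : (n.*2 < N)%N by exact: ltn_expl.
have N0 : (0 < N)%N by exact: leq_ltn_trans nN.
have w1 j : circle R (w ^+ j).
  by rewrite /circle /= normrX (expr_eq1_norm N0 (prim_expr_order wP)) expr1n.
pose p (j : 'I_N) : circle R := exist _ (w ^+ j) (mem_set (w1 j)).
pose kap j t := 1 - nrm (cval (p j) - cval t) ^+ 2 / 4.
have kapE j t : CT_fun (circle_kernel (p j) ^+ n) t = (kap j t ^+ n)%:C.
  by rewrite CT_funX circle_kernelE rmorphXn.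
have kap0 j t : 0 <= kap j t.
  have n1 u : nrm (cval u : R[i]) = 1 by rewrite /nrm circle_norm.
  have := nrmB (cval (p j)) (cval t); rewrite /kap !n1.
  by have := nrm_ge0 (cval (p j) - cval t); nra.
pose c : R := (N * 'C(n.*2, n))%:R / 4 ^+ n.
have c0 : 0 < c.
  by rewrite divr_gt0 ?exprn_gt0 // ltr0n muln_gt0 N0 bin_gt0 -addnn leq_addr.
have sumk t : \sum_j kap j t ^+ n = c.
  apply: (@complexI R); rewrite rmorph_sum /=.
  under eq_bigr do rewrite -kapE CT_funX circle_kernel_fun exprMn.
  rewrite -mulr_sumr (sum_binomial_kernel wP nN (circle_neq0 t)).
  rewrite /c (rmorphM (real_complex R)) fmorphV rmorphXn /= !rmorph_nat.
  by rewrite exprVn mulrC.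
(* An average of the values [f (p j)]: at every t the weights, n-th powers of kernels divided by c,
   sum to 1. *)
exists (\sum_(j < N) (CT_fun f (p j) / c%:C) *: circle_kernel (p j) ^+ n).
  by elim/big_ind: _ => // j _; apply/YZ/YX.
apply: (@le_lt_trans _ _ (e / 2 + 2 * M * (n.*2.+1)%:R * q ^+ n)); last lra.
apply: CT_nrm_le => t.
have -> : CT_fun (f - \sum_(j < N) (CT_fun f (p j) / c%:C) *:
    circle_kernel (p j) ^+ n) t =
    \sum_(j < N) (kap j t ^+ n / c)%:C *: (CT_fun f t - CT_fun f (p j)).
  under [RHS]eq_bigr do rewrite scalerBr.
  rewrite sumrB -scaler_suml -rmorph_sum /= -mulr_suml sumk divff ?gt_eqF //.
  rewrite scale1r; congr (_ - _); rewrite CT_fun_sum; apply: eq_bigr => j _.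
  have -> : CT_fun ((CT_fun f (p j) / c%:C) *: circle_kernel (p j) ^+ n) t =
    CT_fun f (p j) / c%:C * CT_fun (circle_kernel (p j) ^+ n) t by [].
  rewrite kapE -[(c%:C)^-1](fmorphV (real_complex R)) -mulrA.
  by rewrite -(rmorphM (real_complex R)) /= (mulrC c^-1) [LHS]mulrC.
apply: le_trans (nrm_sum _ _ _) _.
(* If t is within d of [p j], f varies by at most e / 2; otherwise the kernel is at most q^n and f
   varies by at most 2M. Adding both bounds covers the two cases. *)
have termP j : nrm ((kap j t ^+ n / c)%:C *: (CT_fun f t - CT_fun f (p j))) <=
    (kap j t ^+ n * (e / 2) + 2 * M * q ^+ n) / c.
  rewrite nrmZr ger0_norm ?divr_ge0 ?exprn_ge0 ?(ltW c0) // mulrAC.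
  rewrite ler_pM2r ?invr_gt0 //.
  have k0 := exprn_ge0 n (kap0 j t); have qn0 := exprn_ge0 n q0.
  have [near|far] := ltP (nrm (cval t - cval (p j))) d.
    by have := fd _ _ near; nra.
  have kq : kap j t ^+ n <= q ^+ n.
    by apply: lerXn2r; rewrite ?nnegrE // /kap /q nrm_distC; nra.
  have := nrmB (CT_fun f t) (CT_fun f (p j)).
  have := CT_nrm_ge f t; have := CT_nrm_ge f (p j); rewrite -/M.
  by have := nrm_ge0 (CT_fun f t - CT_fun f (p j)); nra.
(* The first bounds sum to e / 2, the second to 2M q^n N / c, where N / c <= 2n + 1 by
   [central_bin_ge]. *)
apply: le_trans (ler_sum _ (fun j _ => termP j)) _.
rewrite -mulr_suml big_split /= -mulr_suml sumk sumr_const card_ord mulrDl.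
rewrite mulrAC divff ?gt_eqF // mul1r lerD2l -(mulr_natr _ N).
rewrite ler_pdivrMr //.
rewrite [leRHS](_ : _ = 2 * M * q ^+ n * ((n.*2.+1)%:R * c)); last by ring.
rewrite ler_wpM2l ?mulr_ge0 ?exprn_ge0 //.
rewrite /c mulrA ler_pdivlMr ?exprn_gt0 // -natrX -!natrM ler_nat mulnCA leq_mul2l.
by rewrite central_bin_ge orbT.
Qed.

End Density.

(** * Lower bounds for the norm of a tensor product *)

Section Bump.
Variable R : realType.
Local Notation CT := (Ccircle R).

Lemma nrm_real (a : R) : nrm (a%:C : R[i]) = `|a|.
Proof. by apply: (@complexI R); rewrite -nrmE normc_real. Qed.

(** With r the distance to t0, g is 1 for r <= d / 2, 2 - 2r / d up to r = d, and 0 beyond; h is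
    twice the positive part of d / 2 - r. Both are combinations of absolute values, so continuity is
    automatic. *)
Lemma CT_bump (t0 : circle R) (d : R) : 0 < d -> exists g h : CT,
  [/\ star g = g, nrm g <= 1, h <> 0, g * h = h
    & forall t, d <= nrm (cval t - cval t0) -> CT_fun g t = 0].
Proof.
move=> d0; pose D := CT_abs (CT_id R - cval t0 *: (1 : CT)).
pose dist t := nrm (cval t - cval t0).
have DE t : CT_fun D t = (dist t)%:C.
  have -> : CT_fun D t = `|cval t - cval t0 * 1| by [].
  by rewrite mulr1 nrmE.
have absE (a : R) t : CT_fun (CT_abs (a%:C *: (1 : CT) - D)) t = `|a - dist t|%:C.
  have -> : CT_fun (CT_abs (a%:C *: (1 : CT) - D)) t =
    `|a%:C * 1 - CT_fun D t| by [].
  by rewrite mulr1 DE -(rmorphB (real_complex R)) normc_real.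
pose g : CT := (d^-1)%:C *: (CT_abs (d%:C *: (1 : CT) - D)
  - CT_abs ((d / 2)%:C *: (1 : CT) - D)
  + (d / 2)%:C *: (1 : CT)).
have gE t : CT_fun g t = (d^-1 * (`|d - dist t| - `|d / 2 - dist t| + d / 2))%:C.
  have -> : CT_fun g t = (d^-1)%:C * (CT_fun (CT_abs (d%:C *: (1 : CT) - D)) t
    - CT_fun (CT_abs ((d / 2)%:C *: (1 : CT) - D)) t + (d / 2)%:C * 1) by [].
  rewrite !absE mulr1 -(rmorphB (real_complex R)) -(rmorphD (real_complex R)).
  by rewrite -(rmorphM (real_complex R)).
pose h : CT := (d / 2)%:C *: (1 : CT) - D + CT_abs ((d / 2)%:C *: (1 : CT) - D).
have hE t : CT_fun h t = (d / 2 - dist t + `|d / 2 - dist t|)%:C.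
  have -> : CT_fun h t = (d / 2)%:C * 1 - CT_fun D t
    + CT_fun (CT_abs ((d / 2)%:C *: (1 : CT) - D)) t by [].
  by rewrite absE DE mulr1 -(rmorphB (real_complex R)) -(rmorphD (real_complex R)).
have cases (t : circle R) : [\/ dist t <= d / 2 /\ CT_fun g t = 1,
    (d / 2 <= dist t <= d) /\ (0 <= `|d - dist t| - `|d / 2 - dist t| + d / 2 <= d)
    | d <= dist t /\ CT_fun g t = 0].
  rewrite gE; have [near|far] := leP (dist t) (d / 2).
    apply: Or31; split=> //; rewrite !ger0_norm ?subr_ge0 //; last lra.
    rewrite -[RHS](rmorph1 (real_complex R)); congr (_%:C); field; exact: lt0r_neq0.
  have [mid|ext] := leP (dist t) d.
    apply: Or32; split; first by rewrite ltW.
    by rewrite ger0_norm ?subr_ge0 // ltr0_norm ?subr_lt0 //; lra.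
  apply: Or33; split; first exact: ltW.
  rewrite !ltr0_norm ?subr_lt0 //; rewrite -[RHS](rmorph0 (real_complex R)).
  by congr (_%:C); field; exact: lt0r_neq0.
exists g, h; split.
- apply: CT_eqP => t; have -> : CT_fun (star g) t = (CT_fun g t)^* by [].
  by rewrite gE conjc_real.
- apply: CT_nrm_le => t.
  have [[_ ->]|[_ gb]|[_ ->]] := cases t.
  + by rewrite /nrm normr1.
  + rewrite gE nrm_real ger0_norm.
      by rewrite mulrC ler_pdivrMr // mul1r; case/andP: gb.
    by apply: mulr_ge0; [rewrite invr_ge0 ltW | case/andP: gb].
  + by rewrite nrm0.
- move=> h0; have := hE t0; rewrite h0 /dist subrr nrm0 subr0 ger0_norm; last lra.
  rewrite -[LHS](rmorph0 (real_complex R)) => /complexI; lra.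
- apply: CT_eqP => t; rewrite CT_funM.
  have hfar : d / 2 <= dist t -> CT_fun h t = 0.
    by move=> far; rewrite hE ler0_norm ?subr_le0 // subrr.
  have [[_ ->]|[/andP[/hfar-> _] _]|[far _]] := cases t.
  + by rewrite mul1r.
  + by rewrite mulr0.
  + rewrite hfar ?mulr0 //; apply: le_trans far.
    by rewrite ler_pdivrMr // ler_peMr ?ler1n // ltW.
- move=> t far; rewrite gE !ler0_norm ?subr_le0 //; last by rewrite /dist; lra.
  rewrite -[RHS](rmorph0 (real_complex R)).
  by congr (_%:C); field; exact: lt0r_neq0.
Qed.

Lemma nrm_sub_expr (x y : R[i]) m : `|x| = 1 -> `|y| = 1 ->
  nrm (x ^+ m - y ^+ m) <= m%:R * nrm (x - y).
Proof.
move=> x1 y1; elim: m => [|m IH]; first by rewrite subrr nrm0 mul0r.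
have -> : x ^+ m.+1 - y ^+ m.+1 = x *: (x ^+ m - y ^+ m) + y ^+ m *: (x - y).
  rewrite !exprS.
  have -> : x *: (x ^+ m - y ^+ m) + y ^+ m *: (x - y) =
    x * (x ^+ m - y ^+ m) + y ^+ m * (x - y) by [].
  by ring.
apply: le_trans (nrmD _ _) _; rewrite !nrmZ normrX x1 y1 expr1n !mul1r.
by rewrite -natr1 mulrDl mul1r lerD2r.
Qed.

End Bump.

Section TensorLowerBound.
Variables (R : realType) (B D : cstarAlgType R).
Variables (j1 : B -> D) (j2 : Ccircle R -> D).
Hypotheses (hj1 : is_star_hom j1) (j11 : j1 1 = 1).
Hypotheses (hj2 : is_star_hom j2) (j21 : j2 1 = 1).
Hypothesis j12 : forall x f, j1 x * j2 f = j2 f * j1 x.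
Hypothesis j_inj : forall x f, j1 x * j2 f = 0 -> x = 0 \/ f = 0.
Hypothesis hB : finite_dimensional B.

Lemma tensor_selfadj_lower (b : B) (g h : Ccircle R) :
  star b = b -> h <> 0 -> g * h = h -> nrm b <= nrm (j1 b * j2 g).
Proof.
move=> sb h0 gh; have [n [e span_e]] := hB.
have [|v|c c0 cP] :=
  @finite_dim_bounded_below R B D (fun x => j1 x * j2 h) n e _ _ span_e.
- by move=> a x y; rewrite (star_homP hj1) mulrDl scale_mulAl.
- by move=> /j_inj[].
(* With c the lower bound for x |-> [j1 x * j2 h], the N-th power of |b| is at most |j2 h| / c times
   that of |j1 b * j2 g|. Inserting a factor N >= 1 puts this in the form required here. *)
apply: (@le_of_expr_growth _ _ _ (nrm (j2 h) / c)); rewrite ?nrm_ge0 // => k.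
rewrite -nrm_selfadjX //; set N := (2 ^ k)%N.
have powE : j1 (b ^+ N) * j2 h = (j1 b * j2 g) ^+ N * j2 h.
  rewrite (exprMn_comm _ (j12 b g)) -mulrA -(star_homX hj1) // -(star_homX hj2) //.
  rewrite -(star_homM hj2); congr (_ * j2 _); elim: N => [|m IH].
    by rewrite expr0 mul1r.
  by rewrite exprSr -mulrA gh.
set x := j1 b * j2 g in powE *.
have v0 : 0 <= nrm x ^+ N by rewrite exprn_ge0 ?nrm_ge0.
rewrite [leRHS](_ : _ = (N%:R * (nrm x ^+ N * nrm (j2 h))) / c); last by ring.
rewrite ler_pdivlMr // mulrC.
apply: le_trans (cP _) _; rewrite powE; apply: le_trans (nrmM _ _) _.
apply: le_trans (_ : nrm x ^+ N * nrm (j2 h) <= _).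
  by rewrite ler_wpM2r ?nrm_ge0 ?nrmX.
by rewrite ler_peMl ?ler1n ?expn_gt0 ?mulr_ge0 ?nrm_ge0.
Qed.

(** Reduction to the self-adjoint element [star b * b], with [g * g], which still fixes h. *)
Lemma tensor_lower (b : B) (g h : Ccircle R) :
  star g = g -> h <> 0 -> g * h = h -> nrm b <= nrm (j1 b * j2 g).
Proof.
move=> sg h0 gh; rewrite -(@ler_pXn2r _ 2) ?nnegrE ?nrm_ge0 // -!nrm_starM.
have -> : star (j1 b * j2 g) * (j1 b * j2 g) = j1 (star b * b) * j2 (g * g).
  rewrite star_mul -(star_hom_star hj1) -(star_hom_star hj2) sg.
  rewrite (star_homM hj1) (star_homM hj2) -j12 -!mulrA; congr (_ * _).
  by rewrite !mulrA j12.
apply: tensor_selfadj_lower h0 _; first by rewrite star_mul starK.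
by rewrite -mulrA !gh.
Qed.

(* Multiply by a bump at t0: on its support the polynomial is nearly constant. *)
Lemma tensor_poly_eval_le n (c : nat -> B) (t0 : circle R) :
  nrm (\sum_(m < n) cval t0 ^+ m *: c m) <=
  nrm (\sum_(m < n) j1 (c m) * j2 (CT_id R) ^+ m).
Proof.
set F := \sum_(m < n) _; set x := \sum_(m < n) _.
apply/ler_addgt0Pr => e e0; pose C := \sum_(m < n) nrm (c m).
have C0 : 0 <= C by apply: sumr_ge0 => m _; exact: nrm_ge0.
(* Chosen so that the total error C n d is at most e; the 1 makes the denominator positive. *)
pose d := e / (n%:R * C + 1).
have nC1 : 0 < n%:R * C + 1 by rewrite ltr_wpDl // mulr_ge0.
have d0 : 0 < d by rewrite divr_gt0.
have [g [h [sg g1 h0 gh gfar]]] := CT_bump t0 d0.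
apply: le_trans (tensor_lower F sg h0 gh) _.
(* The error made by freezing the m-th power of the coordinate function at t0, localised by the
   bump. *)
pose y (m : nat) := (cval t0 ^+ m *: (1 : Ccircle R) - CT_id R ^+ m) * g.
have -> : j1 F * j2 g = x * j2 g + \sum_(m < n) j1 (c m) * j2 (y m).
  rewrite (star_hom_sum hj1) !mulr_suml -big_split; apply: eq_bigr => m _ /=.
  rewrite (star_homZ hj1) -(star_homX hj2) // -mulrA -(star_homM hj2) -mulrDr.
  rewrite -(star_homD hj2) /y mulrBl (addrC (CT_id R ^+ m * g)) subrK.
  rewrite (scale_mulAl (cval t0 ^+ m) 1 g) mul1r.
  by rewrite (star_homZ hj2) scale_mulAr scale_mulAl.
apply: le_trans (nrmD _ _) _; apply: lerD.
  apply: le_trans (nrmM _ _) _; rewrite ler_piMr ?nrm_ge0 //.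
  exact: le_trans (star_hom_contractive hj2 g) g1.
have ym m : (m < n)%N -> nrm (y m) <= n%:R * d.
  move=> mn; apply: CT_nrm_le => t; rewrite CT_funM.
  have nd0 : 0 <= n%:R * d by rewrite mulr_ge0 // ltW.
  have [far|near] := leP d (nrm (cval t - cval t0)).
    by rewrite gfar // mulr0 nrm0.
  have -> : CT_fun (cval t0 ^+ m *: (1 : Ccircle R) - CT_id R ^+ m) t * CT_fun g t =
      (cval t0 ^+ m - cval t ^+ m) *: CT_fun g t.
    have -> : CT_fun (cval t0 ^+ m *: (1 : Ccircle R) - CT_id R ^+ m) t =
      cval t0 ^+ m * 1 - CT_fun (CT_id R ^+ m) t by [].
    by rewrite mulr1 CT_funX.
  rewrite nrmZ -/(nrm _); apply: le_trans (_ : m%:R * d * 1 <= _).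
    apply: ler_pM; rewrite ?nrm_ge0 //; last exact: le_trans (CT_nrm_ge g t) g1.
    apply: le_trans (nrm_sub_expr _ (circle_norm _) (circle_norm _)) _.
    by rewrite ler_wpM2l // nrm_distC ltW.
  by rewrite mulr1; apply: ler_wpM2r; [exact: ltW | rewrite ler_nat ltnW].
apply: le_trans (nrm_sum _ _ _) _.
apply: le_trans (_ : \sum_(m < n) nrm (c m) * (n%:R * d) <= _).
  apply: ler_sum => m _; apply: le_trans (nrmM _ _) _.
  apply: ler_pM; rewrite ?nrm_ge0 ?(star_hom_contractive hj1) //.
  exact: le_trans (star_hom_contractive hj2 _) (ym _ (ltn_ord m)).
rewrite -mulr_suml -/C mulrA /d mulrA ler_pdivrMr // mulrC (mulrC C).
by apply: ler_wpM2l; [exact: ltW | rewrite lerDl].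
Qed.

Lemma tensor_poly_coef_le n (c : nat -> B) m : (m < n)%N ->
  nrm (c m) <= nrm (\sum_(l < n) j1 (c l) * j2 (CT_id R) ^+ l).
Proof.
move=> mn; apply: (fourier_coef_le _ mn) => z z1.
exact: (tensor_poly_eval_le n c (exist _ z (mem_set z1))).
Qed.

End TensorLowerBound.

(** * Polynomials in a unitary *)

Section Subalgebras.
Variable R : realType.

Lemma closure_cstar_subalgebra (A : cstarAlgType R) (Y : set A) :
  Y 1 -> (forall (c : R[i]) x y, Y x -> Y y -> Y (c *: x + y)) ->
  (forall x y, Y x -> Y y -> Y (x * y)) -> (forall x, Y x -> Y (star x)) ->
  is_cstar_subalgebra (closure Y).
Proof.
move=> Y1 YP YM Ys; split; first exact: closed_closure.
- exact: subset_closure.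
- move=> c x y /closure_nrm Yx /closure_nrm Yy; apply/closure_nrm => e e0.
  pose a := nrm (c : R[i]); have a0 : 0 <= a := nrm_ge0 _.
  have d0 : 0 < e / (a + 1) by rewrite divr_gt0 //; lra.
  have [x' Yx' xx'] := Yx _ d0; have [y' Yy' yy'] := Yy _ d0.
  exists (c *: x' + y'); first exact: YP.
  rewrite opprD addrACA -scalerBr; apply: le_lt_trans (nrmD _ _) _.
  rewrite nrmZ -[complex.Re `|c|]/a; move: xx' yy'; rewrite !ltr_pdivlMr; try lra.
  by have := nrm_ge0 (x - x'); nra.
- move=> x y /closure_nrm Yx /closure_nrm Yy; apply/closure_nrm => e e0.
  pose a := nrm x + nrm y + 1.
  have a1 : 1 <= a by have := nrm_ge0 x; have := nrm_ge0 y; rewrite /a; lra.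
  (* The first-order errors are at most d (|x| + |y|). As d <= 1, the second-order one is less than
     d, and the total is below d a <= e. *)
  pose d := Num.min 1 (e / a).
  have d0 : 0 < d by rewrite lt_min ltr01 divr_gt0 //; lra.
  have d1 : d <= 1 by rewrite ge_min lexx.
  have de : d * a <= e by rewrite -ler_pdivlMr ?ge_min ?lexx ?orbT //; lra.
  have [x' Yx' xx'] := Yx _ d0; have [y' Yy' yy'] := Yy _ d0.
  exists (x' * y'); first exact: YM.
  have -> : x * y - x' * y' = (x - x') * y + (x * (y - y') - (x - x') * (y - y')).
    rewrite -mulrBl [x - (x - x')](_ : _ = x'); last by rewrite opprB addrC subrK.
    by rewrite mulrBl mulrBr addrA subrK.
  apply: le_lt_trans (nrmD _ _) _.
  have := nrmB (x * (y - y')) ((x - x') * (y - y')).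
  have := nrmM (x - x') y; have := nrmM x (y - y').
  have := nrmM (x - x') (y - y').
  have := nrm_ge0 x; have := nrm_ge0 y.
  have := nrm_ge0 (x - x'); have := nrm_ge0 (y - y').
  rewrite /a in de; nra.
- move=> x /closure_nrm Yx; apply/closure_nrm => e /Yx[y Yy xy].
  by exists (star y); [exact: Ys | rewrite -starB nrm_star].
Qed.

Lemma preimage_cstar_subalgebra (A D : cstarAlgType R) (phi : A -> D) (Y : set D) :
  is_star_hom phi -> phi 1 = 1 -> is_cstar_subalgebra Y ->
  is_cstar_subalgebra (phi @^-1` Y).
Proof.
move=> hphi phi1 [cY Y1 YP YM Ys]; split.
- apply/closed_nrm => x xY; apply/(closed_nrm Y).1 => // e /xY[y Yy xy].
  exists (phi y) => //; rewrite -(star_homB hphi).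
  exact: le_lt_trans (star_hom_contractive hphi _) xy.
- by rewrite /preimage /= phi1.
- by move=> c x y Yx Yy; rewrite /preimage /= (star_homP hphi); exact: YP.
- by move=> x y Yx Yy; rewrite /preimage /= (star_homM hphi); exact: YM.
- by move=> x Yx; rewrite /preimage /= (star_hom_star hphi); exact: Ys.
Qed.

(** Closedness is the point: since [phi] is bounded below, preimages of a convergent sequence form a
    Cauchy sequence, and A is complete. *)
Lemma range_cstar_subalgebra (A D : cstarAlgType R) (phi : A -> D) :
  is_star_hom phi -> phi 1 = 1 -> (forall x, nrm x <= nrm (phi x)) ->
  is_cstar_subalgebra (range phi).
Proof.
move=> hphi phi1 iso; split.
- apply/closed_nrm => z zP.
  have /choice[x xP] : forall n : nat, exists x : A, nrm (z - phi x) < n.+1%:R^-1.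
    move=> n; have [|_ [x _ <-] zx] := zP n.+1%:R^-1; first by rewrite invr_gt0.
    by exists x.
  have small e : 0 < e -> exists N, forall n, (N <= n)%N -> nrm (z - phi (x n)) < e.
    move=> e0; exists (Num.truncn e^-1) => n Nn; apply: lt_trans (xP n) _.
    rewrite invf_plt ?posrE //; apply: lt_le_trans (truncnS_gt _) _.
    by rewrite ler_nat ltnS.
  have [|l xl] := nrm_cauchy_cvg (w := x).
    move=> e e0; have e2 : 0 < e / 2 by rewrite divr_gt0.
    have [N NP] := small _ e2; exists N => m n Nm Nn.
    apply: le_lt_trans (iso _) _; rewrite (star_homB hphi).
    apply: le_lt_trans (nrm_dist_tri _ z _) _.
    by rewrite nrm_distC [e]splitr; apply: ltrD; exact: NP.
  exists l => //; apply/eqP; rewrite -subr_eq0; apply/eqP.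
  apply: nrm_limP => e e0; have e2 : 0 < e / 2 by rewrite divr_gt0.
  have [N NP] := small _ e2; have [M MP] := xl _ e2; set n := maxn N M.
  apply: le_trans (nrm_dist_tri _ (phi (x n)) _) _; rewrite [e]splitr.
  apply: lerD; last by rewrite nrm_distC; apply/ltW/NP; exact: leq_maxl.
  rewrite -(star_homB hphi); apply: le_trans (star_hom_contractive hphi _) _.
  by rewrite nrm_distC; apply/ltW/MP; exact: leq_maxr.
- by exists 1.
- move=> c _ _ [x _ <-] [y _ <-]; exists (c *: x + y) => //.
  by rewrite (star_homP hphi).
- by move=> _ _ [x _ <-] [y _ <-]; exists (x * y); rewrite // (star_homM hphi).
- by move=> _ [x _ <-]; exists (star x); rewrite // (star_hom_star hphi).
Qed.

End Subalgebras.

Section UnitaryPolynomials.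
Variables (R : realType) (B E D : cstarAlgType R).
Variables (pi : B -> E) (u : E).
Hypotheses (hpi : is_star_hom pi) (pi1 : pi 1 = 1).
Hypotheses (usu : star u * u = 1) (uus : u * star u = 1).
Hypothesis upi : forall b, u * pi b = pi b * u.

(* Not expressed with {poly B}, which does not exist for the zero algebra B. *)
Definition upoly n (x : E) :=
  exists b : nat -> B, x = \sum_(m < n) pi (b m) * u ^+ m.

Lemma upoly_comm n x : upoly n x -> x * u = u * x.
Proof.
move=> [b ->]; rewrite mulr_suml mulr_sumr; apply: eq_bigr => m _.
by rewrite -mulrA -exprSr exprS !mulrA upi.
Qed.

Lemma upolyD n x y : upoly n x -> upoly n y -> upoly n (x + y).
Proof.
move=> [b ->] [c ->]; exists (fun m => b m + c m).
by rewrite -big_split; apply: eq_bigr => m _; rewrite (star_homD hpi) mulrDl.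
Qed.

Lemma upoly0 n : upoly n 0.
Proof.
by exists (fun=> 0); rewrite big1 // => m _; rewrite (star_hom0 hpi) mul0r.
Qed.

Lemma upoly_sum n (I : Type) (r : seq I) (P : pred I) (F : I -> E) :
  (forall i, upoly n (F i)) -> upoly n (\sum_(i <- r | P i) F i).
Proof.
move=> FP; elim/big_ind: _ => //; [exact: upoly0 | exact: upolyD].
Qed.

Lemma upoly_monomial n m b : (m < n)%N -> upoly n (pi b * u ^+ m).
Proof.
move=> mn; exists (fun k => if k == m then b else 0).
rewrite (bigD1 (Ordinal mn)) //= eqxx big1 ?addr0 // => k.
rewrite -val_eqE /= => /negPf->.
by rewrite (star_hom0 hpi) mul0r.
Qed.

Lemma upoly_shift n k m b x : upoly n x -> (n + m <= k)%N ->
  upoly k (pi b * u ^+ m * x).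
Proof.
move=> [c ->] nmk; rewrite mulr_sumr; apply: upoly_sum => l.
rewrite -mulrA.
have -> : u ^+ m * (pi (c l) * u ^+ l) = pi (c l) * u ^+ (m + l).
  rewrite exprD !mulrA; congr (_ * _); elim: m {nmk} => [|m IH].
    by rewrite mul1r mulr1.
  by rewrite exprS -mulrA IH mulrA upi -!mulrA.
rewrite mulrA -(star_homM hpi); apply: upoly_monomial.
by apply: leq_trans nmk; rewrite addnC ltn_add2r.
Qed.

Lemma upolyM n k x y : upoly n x -> upoly k y -> upoly (n + k) (x * y).
Proof.
move=> [b ->] yP; rewrite mulr_suml; apply: upoly_sum => m.
by apply: upoly_shift yP _; rewrite addnC leq_add2r ltnW.
Qed.

Lemma upolyMu n m x : upoly n x -> upoly (n + m) (u ^+ m * x).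
Proof. by move=> xP; rewrite -[u ^+ m]mul1r -pi1; exact: upoly_shift xP _. Qed.

Lemma upolyZ n (c : R[i]) x : upoly n x -> upoly n (c *: x).
Proof.
move=> [b ->]; exists (fun m => c *: b m); rewrite scaler_sumr.
by apply: eq_bigr => m _; rewrite (star_homZ hpi) scale_mulAl.
Qed.

Lemma upolyX n k x : upoly n x -> upoly (n * k).+1 (x ^+ k).
Proof.
move=> xP; elim: k => [|k IH].
  have := @upoly_monomial (n * 0).+1 0 1 isT.
  by rewrite pi1 mul1r.
by rewrite exprS mulnS -addnS; exact: upolyM.
Qed.

Lemma usuX k : star u ^+ k * u ^+ k = 1.
Proof.
elim: k => [|k IH]; first by rewrite mulr1.
by rewrite exprSr exprS -mulrA (mulrA (star u)) usu mul1r.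
Qed.

Lemma uusX k : u ^+ k * star u ^+ k = 1.
Proof.
elim: k => [|k IH]; first by rewrite mulr1.
by rewrite exprSr exprS -mulrA (mulrA u) uus mul1r.
Qed.

(** The adjoint of a term of degree m < n has degree -m in u; the factor u^n moves it to n - m <= n,
    hence the size n + 1. *)
Lemma upoly_star n x : upoly n x -> upoly n.+1 (u ^+ n * star x).
Proof.
move=> [b ->]; rewrite (big_morph star (@starD R E) (star0 E)) mulr_sumr.
apply: upoly_sum => m; rewrite star_mul starX -(star_hom_star hpi).
have mn : (m <= n)%N by exact/ltnW.
have un : u ^+ n = u ^+ (n - m) * u ^+ m by rewrite -exprD subnK.
rewrite mulrA un -(mulrA _ (u ^+ m)) uusX mulr1.
have -> : u ^+ (n - m) * pi (star (b m)) = pi (star (b m)) * u ^+ (n - m).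
  elim: (n - m)%N => [|k IH]; first by rewrite mul1r mulr1.
  by rewrite exprS -mulrA IH mulrA upi -!mulrA.
by apply: upoly_monomial; rewrite ltnS leq_subr.
Qed.

Lemma nrm_mul_uX k x : nrm (u ^+ k * x) = nrm x.
Proof.
have u1 j : nrm (u ^+ j) <= 1 by apply: nrm_unit_le1; rewrite starX usuX.
have us1 j : nrm (star u ^+ j) <= 1 by rewrite -starX nrm_star.
apply/eqP; rewrite eq_le; apply/andP; split.
  by apply: le_trans (nrmM _ _) _; rewrite ler_piMl ?nrm_ge0.
rewrite -{1}[x]mul1r -(usuX k) -mulrA.
by apply: le_trans (nrmM _ _) _; rewrite ler_piMl ?nrm_ge0.
Qed.

(** Negative powers are encoded by clearing a denominator u^d. Commutation with u lets powers of u
    move past x in products and adjoints. *)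
Definition laurent (x : E) := x * u = u * x /\ exists d n, upoly n (u ^+ d * x).

Lemma commX_of_comm x k : x * u = u * x -> x * u ^+ k = u ^+ k * x.
Proof.
move=> xu; elim: k => [|k IH]; first by rewrite mulr1 mul1r.
by rewrite exprS mulrA xu -!mulrA IH.
Qed.

Lemma star_comm x : x * u = u * x -> star x * u = u * star x.
Proof.
move=> xu; have sx : star u * x = x * star u.
  by rewrite -[LHS]mulr1 -uus -!mulrA (mulrA x) xu !mulrA usu mul1r.
by rewrite -[u in LHS]starK -star_mul sx star_mul starK.
Qed.

Lemma laurent_subalgebra : is_cstar_subalgebra (closure laurent).
Proof.
apply: closure_cstar_subalgebra.
- split; first by rewrite mul1r mulr1.
  by exists 0, 1%N; rewrite mulr1 -[X in upoly _ X]mul1r -pi1; exact: upoly_monomial.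
- move=> c x y [xu [d [n xP]]] [yu [d' [n' yP]]]; split.
    by rewrite mulrDl mulrDr scale_mulAl scale_mulAr xu yu.
  (* A common denominator; each summand is shifted by the denominator of the other, and the sum of
     the two resulting sizes accommodates both. *)
  exists (d + d')%N, ((n + d') + (n' + d))%N; rewrite mulrDr scale_mulAr.
  have widen k k' z : (k <= k')%N -> upoly k z -> upoly k' z.
    move=> kk' zP; rewrite -[z]mul1r -[1]mulr1 -{1}pi1 -(expr0 u).
    by apply: upoly_shift zP _; rewrite addn0.
  apply: upolyD; [apply: upolyZ|].
    rewrite (addnC d) exprD -mulrA; apply: (widen (n + d')%N); first exact: leq_addr.
    exact: upolyMu.
  rewrite exprD -mulrA; apply: (widen (n' + d)%N); first exact: leq_addl.
  exact: upolyMu.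
- move=> x y [xu [d [n xP]]] [yu [d' [n' yP]]]; split.
    by rewrite -mulrA yu !mulrA xu.
  exists (d + d')%N, (n + n')%N.
  have -> : u ^+ (d + d') * (x * y) = (u ^+ d * x) * (u ^+ d' * y).
    by rewrite exprD -!mulrA (mulrA x) (commX_of_comm _ xu) !mulrA.
  exact: upolyM.
- move=> x [xu [d [n xP]]]; split; first exact: star_comm.
  exists n, (n.+1 + d)%N.
  have -> : u ^+ n * star x = u ^+ d * (u ^+ n * star (u ^+ d * x)).
    rewrite star_mul starX mulrA -exprD addnC exprD -!mulrA; congr (_ * _).
    rewrite mulrA -(commX_of_comm _ (star_comm xu)) -mulrA uusX mulr1 //.
  exact/upolyMu/upoly_star.
Qed.

End UnitaryPolynomials.

(** * Isometry on the closure of the Laurent polynomials *)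

Section Isometry.
Variables (R : realType) (B E D : cstarAlgType R).
Variables (pi : B -> E) (u : E) (psi : E -> D).
Hypotheses (hpi : is_star_hom pi) (pi1 : pi 1 = 1).
Hypotheses (usu : star u * u = 1) (uus : u * star u = 1).
Hypothesis upi : forall b, u * pi b = pi b * u.
Hypotheses (hpsi : is_star_hom psi) (psi1 : psi 1 = 1).
Hypothesis coef_le : forall n (b : nat -> B) m, (m < n)%N ->
  nrm (b m) <= nrm (psi (\sum_(l < n) pi (b l) * u ^+ l)).

Lemma upoly_nrm_le_size n x : upoly pi u n x -> nrm x <= n%:R * nrm (psi x).
Proof.
move=> [b xE]; rewrite {1}xE; apply: le_trans (nrm_sum _ _ _) _.
apply: le_trans (_ : \sum_(m < n) nrm (psi x) <= _); last first.
  by rewrite sumr_const card_ord mulr_natl.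
apply: ler_sum => m _; rewrite xE; apply: le_trans (coef_le _ (ltn_ord m)).
apply: le_trans (nrmM _ _) _; rewrite -[leRHS]mulr1.
apply: ler_pM; rewrite ?nrm_ge0 ?(star_hom_contractive hpi) //.
by apply: nrm_unit_le1; rewrite starX usuX.
Qed.

(* The linear factor in the previous bound disappears on applying it to large
   powers of x^* x, shifted by a power of u to remove negative exponents. *)
Lemma upoly_nrm_le n x : upoly pi u n x -> nrm x <= nrm (psi x).
Proof.
move=> xP; rewrite -(@ler_pXn2r _ 2) ?nnegrE ?nrm_ge0 // -nrm_starM.
set s := star x * x; have sxu := star_comm usu uus (upoly_comm upi xP).
have su : s * u = u * s by rewrite -mulrA (upoly_comm upi xP) !mulrA sxu.
pose y := u ^+ n * s.
have yP : upoly pi u (n.+1 + n) y.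
  rewrite /y mulrA; apply: upolyM => //; exact: upoly_star.
have ss : star s = s by rewrite star_mul starK.
(* y has size 2n + 1, so y^N has size (2n + 1) N + 1 <= (2n + 2) N. *)
apply: (@le_of_expr_growth _ _ _ (n.*2.+2)%:R);
  rewrite ?nrm_ge0 ?exprn_ge0 ?nrm_ge0 // => k.
rewrite -(nrm_selfadjX k ss); set N := (2 ^ k)%N.
have yN : y ^+ N = u ^+ (n * N) * s ^+ N.
  by rewrite exprM -exprMn_comm //; exact/esym/commX_of_comm.
rewrite -(nrm_mul_uX usu (n * N)) -yN.
apply: le_trans (upoly_nrm_le_size (upolyX hpi pi1 upi N yP)) _.
have nyN : nrm (psi (y ^+ N)) <= (nrm (psi x) ^+ 2) ^+ N.
  rewrite (star_homX hpsi) //; apply: le_trans (nrmX _ _) _.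
  apply: lerXn2r; rewrite ?nnegrE ?nrm_ge0 ?exprn_ge0 ?nrm_ge0 //.
  rewrite /y (star_homM hpsi) (star_homX hpsi) //.
  apply: le_trans (nrmM _ _) _; rewrite /s (star_homM hpsi) (star_hom_star hpsi).
  rewrite nrm_starM ler_piMl ?exprn_ge0 ?nrm_ge0 //.
  apply: nrm_unit_le1; rewrite -(star_homX hpsi) // -(star_hom_star hpsi).
  by rewrite -(star_homM hpsi) starX usuX.
rewrite -natrM; apply: ler_pM; rewrite ?nrm_ge0 // ler_nat.
rewrite addSn addnn (mulSn n.*2.+1) -add1n leq_add2r.
by rewrite expn_gt0.
Qed.

Lemma laurent_nrm_le x : laurent pi u x -> nrm x <= nrm (psi x).
Proof.
move=> [xu [d [n xP]]]; rewrite -(nrm_mul_uX usu d).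
apply: le_trans (upoly_nrm_le xP) _; rewrite (star_homM hpsi).
apply: le_trans (nrmM _ _) _; rewrite ler_piMl ?nrm_ge0 //.
apply: nrm_unit_le1; rewrite -(star_hom_star hpsi) -(star_homM hpsi).
by rewrite starX usuX.
Qed.

Lemma closure_laurent_nrm_le x : closure (laurent pi u) x -> nrm x <= nrm (psi x).
Proof.
move=> /closure_nrm xcl; apply/ler_addgt0Pr => e e0.
have e2 : 0 < e / 2 by rewrite divr_gt0.
have [y /laurent_nrm_le yP xy] := xcl _ e2.
have := nrm_dist_tri x y 0; have := nrm_dist_tri (psi y) (psi x) 0.
rewrite !subr0 -(star_homB hpsi); have := star_hom_contractive hpsi (y - x).
rewrite (nrm_distC y); lra.
Qed.

End Isometry.

(** * Construction of the isomorphism *)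

Theorem proposition4p6 (R : realType) (B : cstarAlgType R)
    (hB : finite_dimensional B) (E D : cstarAlgType R)
    (hE : is_exel_crossed_product (trivial_exel B) E)
    (hD : is_cstar_tensor B (Ccircle R) D) :
  cstar_isomorphic E D.
Proof.
have [T [i [S [q [[[hi i1 iS iSS] Tgen Tuniv] [hq qsurj qker]]]]]] := hE.
have [j1 [j2 [[hj1 j11] [hj2 j21] j12 j_free Ddense]]] := hD.
have [id_su id_us] := CT_id_unitary R.
pose V := j2 (CT_id R).
have VsV : star V * V = 1 by rewrite -(star_hom_star hj2) -(star_homM hj2) id_su.
have VVs : V * star V = 1 by rewrite -(star_hom_star hj2) -(star_homM hj2) id_us.
(* The injectivity condition for a family of one element, independent when x != 0. *)
have j_inj x f : j1 x * j2 f = 0 -> x = 0 \/ f = 0.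
  move=> xf0; have [->|x0] := eqVneq x 0; [by left | right].
  apply: (j_free 1%N (fun=> x) (fun=> f) _ _ ord0); last by rewrite big_ord1.
  move=> c; rewrite big_ord1 => cx0 k; rewrite ord1; apply/eqP.
  apply: contraNT x0 => c0; apply/eqP.
  by rewrite -[x](scalerK c0) cx0 scaler0.
have [phi [hphi phi1 phii phiS]] : exists phi : T -> D,
    [/\ is_star_hom phi, phi 1 = 1, forall f, phi (i f) = j1 f & phi S = V].
  apply: Tuniv; split=> //= f; first by rewrite j12.
  by rewrite -(star_hom_star hj2) -j12 -mulrA (star_hom_star hj2) VsV mulr1.
have phi_ideal x : redundancy_ideal i S x -> phi x = 0.
  move=> Jx; apply: (Jx [set y | phi y = 0]); split.
    split.
    - apply/closed_nrm => y yP; apply: nrm_limP => e /yP[z z0 yz].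
      rewrite -[phi y]subr0 -z0 -(star_homB hphi).
      exact: le_trans (star_hom_contractive hphi _) (ltW yz).
    - exact: star_hom0.
    - by move=> c y z /= y0 z0; rewrite (star_homP hphi) y0 z0 scaler0 addr0.
    - by move=> a y /= y0; rewrite !(star_homM hphi) y0 mulr0 mul0r.
  move=> _ [f [k [[_ fk] ->]]].
  (* At g = 1 the redundancy gives [phi (i f) * V = phi k * V], and V can be cancelled since
     [V * star V = 1]. *)
  have := congr1 phi (fk 1); rewrite i1 !mulr1 !(star_homM hphi) phiS => fkV.
  rewrite /= (star_homB hphi) -[phi k]mulr1 -VVs mulrA -fkV -mulrA VVs mulr1.
  by rewrite subrr.
have q1 : q 1 = 1.
  by have [x qx] := qsurj 1; rewrite -[LHS]mulr1 -{1}qx -(star_homM hq) mul1r.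
pose u := q S; pose pi b := q (i b).
have usu : star u * u = 1.
  rewrite -(star_hom_star hq) -(star_homM hq) -q1; congr q.
  by have := iSS 1; rewrite /= i1 mulr1.
have uus : u * star u = 1.
  rewrite -(star_hom_star hq) -(star_homM hq).
  apply/eqP; rewrite eq_sym -subr_eq0 -q1 -(star_homB hq); apply/eqP/qker.
  (* The redundancy (1, [S * star S]): as S commutes with [i g] and [star S * S = 1], one has
     [S * star S * i g * S = S * i g = i g * S]. *)
  move=> A [_]; apply; exists 1, (S * star S); rewrite i1; split=> //; split.
    apply: subset_closure; exists 1%N, (fun=> 1), (fun=> S * star S).
    rewrite big_ord1 scale1r; split=> // _; exists 1, 1.
    by rewrite i1 mul1r mulr1.
  move=> g; have SsS : star S * S = 1 by have := iSS 1; rewrite /= i1 mulr1.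
  by rewrite i1 mul1r -!mulrA -[i g * S]iS /= (mulrA (star S)) SsS mul1r.
have hpi : is_star_hom pi.
  split=> [c x y|x y|x]; rewrite /pi.
  - by rewrite (star_homP hi) (star_homP hq).
  - by rewrite (star_homM hi) (star_homM hq).
  - by rewrite (star_hom_star hi) (star_hom_star hq).
have pi1 : pi 1 = 1 by rewrite /pi i1.
have upi b : u * pi b = pi b * u by rewrite -!(star_homM hq) iS.
(* The factorisation of [phi] through q, defined by a set-theoretic section; the choice is
   immaterial because [phi] vanishes on the kernel of q. *)
have [g gK] := choice qsurj.
pose psi y := phi (g y).
have psiq x : psi (q x) = phi x.
  apply/eqP; rewrite -subr_eq0 -(star_homB hphi); apply/eqP/phi_ideal/qker.
  by rewrite (star_homB hq) gK subrr.
have hpsi : is_star_hom psi.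
  split=> [c x y|x y|x]; rewrite -[x]gK.
  - by rewrite -[y]gK -(star_homP hq) !psiq (star_homP hphi).
  - by rewrite -[y]gK -(star_homM hq) !psiq (star_homM hphi).
  - by rewrite -(star_hom_star hq) !psiq (star_hom_star hphi).
have psi1 : psi 1 = 1 by rewrite -q1 psiq.
have psi_pi b : psi (pi b) = j1 b by rewrite /pi psiq.
have psi_u : psi u = V by rewrite psiq.
have coef_le n (b : nat -> B) m : (m < n)%N ->
    nrm (b m) <= nrm (psi (\sum_(l < n) pi (b l) * u ^+ l)).
  move=> mn; rewrite (star_hom_sum hpsi).
  under eq_bigr do rewrite (star_homM hpsi) (star_homX hpsi) // psi_pi psi_u.
  exact: tensor_poly_coef_le.
(* The preimage under q of the closed algebra of Laurent polynomials is a C*-subalgebra of T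
   containing the generators, hence all of T. *)
have dense x : closure (laurent pi u) x.
  have [t <-] := qsurj x; have : setT t by [].
  rewrite -Tgen => /(_ (q @^-1` closure (laurent pi u))); apply; split.
    exact: preimage_cstar_subalgebra hq q1 (laurent_subalgebra hpi pi1 usu uus upi).
  move=> _ [[b _ <-]|->]; apply: subset_closure; split=> //.
  - exact/esym/upi.
  - exists 0, 1%N; rewrite mul1r -[q (i b)]mulr1.
    exact: (@upoly_monomial _ _ _ pi u hpi 1 0 b).
  - exists 0, 2%N; rewrite mul1r -[q S]mul1r -pi1.
    exact: (@upoly_monomial _ _ _ pi u hpi 2 1 1).
have iso x : nrm x <= nrm (psi x).
  exact: (closure_laurent_nrm_le hpi pi1 usu uus upi hpsi psi1 coef_le).
have rangeP := range_cstar_subalgebra hpsi psi1 iso.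
(* The preimage under [j2] of the range of [psi] is a C*-subalgebra of C(T) containing the
   coordinate function. *)
have range_j2 f : range psi (j2 f).
  apply: (CT_subalgebra_full (preimage_cstar_subalgebra hj2 j21 rangeP)).
  by exists u.
(* The range is closed and contains all elementary tensors, whose span is dense. *)
have surj y : exists x, psi x = y.
  have [cR _ RP RM _] := rangeP.
  have : closure (range psi) y.
    have : setT y by []; rewrite -Ddense.
    apply: closure_subset => _ [n [c [z [zP ->]]]].
    elim/big_ind: _ => [|a b Ra Rb|k _].
    - by exists 0; rewrite ?(star_hom0 hpsi).
    - by rewrite -[a]scale1r; exact: RP.
    - have [x [f ->]] := zP k; rewrite -[_ *: _]addr0; apply: RP.
        by apply: RM => //; exists (pi x).
      by exists 0; rewrite ?(star_hom0 hpsi).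
  by move=> /cR[x _ <-]; exists x.
exists psi => //; have [r rK] := choice surj.
exists r => // x; apply/eqP; rewrite -subr_eq0; apply/eqP/nrm_le0.
by apply: le_trans (iso _) _; rewrite (star_homB hpsi) rK subrr nrm0.
Qed.
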